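(* There exists a family of positive finite constants $(\mathbf{C}(d_1,d_2))_{d_1\ge 1,\,d_2\ge 0}$ such that for every $d\ge 2$ and every $z\in\mathbb{R}^d\setminus\{0\}$, \[ \boldsymbol{\mu}_\epsilon(z)=\|z\|_1-\mathbf{C}\big(d_1(z),d_2(z)\big)\,\gamma(z)\,\epsilon^{1/d_1(z)}+o\big(\epsilon^{1/d_1(z)}\big)\quad\text{as }\epsilon\to 0 . \]
   Context: Bernoulli bond first-passage percolation on $\mathbb{Z}^d$, $d\ge 2$, $\epsilon\in[0,1]$: $\mathbb{E}^d$ is the set of edges between vertices of $\mathbb{Z}^d$ at Euclidean distance $1$; $(\boldsymbol{\tau}_\epsilon(u))_{u\in\mathbb{E}^d}$ are i.i.d. with $\mathbb{P}(\boldsymbol{\tau}_\epsilon(u)=1)=1-\epsilon$, $\mathbb{P}(\boldsymbol{\tau}_\epsilon(u)=0)=\epsilon$; an edge is open if its passage time is $0$. For a nearest-neighbour path $\pi$ with edges $u_1,\dots,u_n$, $\boldsymbol{\tau}_\epsilon(\pi)=\sum_{i=1}^n\boldsymbol{\tau}_\epsilon(u_i)$ and $\mathbf{T}_\epsilon(x,y)=\inf_{\pi:x\to y}\boldsymbol{\tau}_\epsilon(\pi)$. For $z\in\mathbb{R}^d\setminus\{0\}$, $\boldsymbol{\mu}_\epsilon(z)=\lim_{n\to\infty}\mathbf{T}_\epsilon(0,\lfloor nz\rfloor)/n$ (a.s. and in $L^1$; equivalently the limit of $\frac1n\mathbb{E}[\mathbf{T}_\epsilon(0,\lfloor nz\rfloor)]$),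 where $\lfloor\cdot\rfloor$ is the coordinatewise integer part. For $z=(z_1,\dots,z_d)$: $d_1(z)=\#\{i:z_i\neq 0\}$, $d_2(z)=d-d_1(z)$, and $\gamma(z)=\prod_{i:z_i\neq0}|z_i|^{1/d_1(z)}$. *)

(* Defs.v *)
From HB Require Import structures.
From mathcomp Require Import all_boot all_order all_algebra.
From mathcomp Require Import all_classical all_reals all_analysis.
Set Implicit Arguments. Unset Strict Implicit. Unset Printing Implicit Defensive.
Import Order.TTheory GRing.Theory Num.Theory.
Import numFieldNormedType.Exports.
Local Open Scope classical_set_scope.
Local Open Scope ring_scope.

Definition vertex (d : nat) := 'rV[int]_d.
Definition unitv (d : nat) (i : 'I_d) : vertex d := delta_mx 0 i.

(* Edges of E^d: the edge (x, i) is the unordered pair {x, x + e_i}.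
   Every pair of vertices at Euclidean distance 1 is of this form for a
   unique (x, i), so this type is in bijection with E^d. *)
Definition edge (d : nat) := (vertex d * 'I_d)%type.

(* A nearest-neighbour step: move along coordinate i, in the positive
   direction if the boolean is true, negative otherwise. A nearest-neighbour
   path from x is a start point x together with a list of steps. *)
Definition step (d : nat) := ('I_d * bool)%type.

Definition step_next d (v : vertex d) (s : step d) : vertex d :=
  if s.2 then v + unitv s.1 else v - unitv s.1.

Definition step_edge d (v : vertex d) (s : step d) : edge d :=
  if s.2 then (v, s.1) else (v - unitv s.1, s.1).

Fixpoint path_end d (v : vertex d) (p : seq (step d)) : vertex d :=
  if p is s :: p' then path_end (step_next v s) p' else v.

Fixpoint path_time d (R : realType) (tau : edge d -> R) (v : vertex d)
    (p : seq (step d)) : R :=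
  if p is s :: p' then tau (step_edge v s) + path_time tau (step_next v s) p'
  else 0.

Definition fpp_time d (R : realType) (tau : edge d -> R) (x y : vertex d)
  : \bar R :=
  ereal_inf [set (path_time tau x p)%:E | p in [set p | path_end x p = y]].

Definition mutually_independent (d0 : measure_display) (Om : measurableType d0)
    (R : realType) (I : eqType) (P : probability Om R) (X : I -> Om -> R) :=
  forall (s : seq I) (B : I -> set R), uniq s ->
    (forall i, measurable (B i)) ->
    P (\bigcap_(i in [set` s]) (X i @^-1` B i)) =
    (\prod_(i <- s) P (X i @^-1` B i))%E.

Definition bernoulli_fpp (d0 : measure_display) (Om : measurableType d0)
    (R : realType) (d : nat) (eps : R) (P : probability Om R)
    (tau : edge d -> Om -> R) :=
  [/\ forall u, measurable_fun setT (tau u),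
      forall u, P [set w | tau u w = 1] = (1 - eps)%:E,
      forall u, P [set w | tau u w = 0] = eps%:E &
      mutually_independent P tau].

Definition floorv (R : realType) d (z : 'rV[R]_d) : vertex d :=
  \row_i Num.floor (z 0 i).

(* mu(z) = lim_n E[T(0, floor(n z))] / n  (indexed by n+1 >= 1) *)
Definition time_constant_seq (d0 : measure_display) (Om : measurableType d0)
    (R : realType) d (P : probability Om R) (tau : edge d -> Om -> R)
    (z : 'rV[R]_d) (n : nat) : R :=
  fine (\int[P]_w fpp_time (tau^~ w) (0 : vertex d)%R (floorv (n.+1%:R *: z)))
    / n.+1%:R.

Definition time_constant (d0 : measure_display) (Om : measurableType d0)
    (R : realType) d (P : probability Om R) (tau : edge d -> Om -> R)
    (z : 'rV[R]_d) : R :=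
  limn (time_constant_seq P tau z).

Definition norm1 (R : realType) d (z : 'rV[R]_d) : R := \sum_i `|z 0 i|.
Definition d1 (R : realType) d (z : 'rV[R]_d) : nat := #|[set i | z 0 i != 0]|.
Definition d2 (R : realType) d (z : 'rV[R]_d) : nat := (d - d1 z)%N.
Definition gammaz (R : realType) d (z : 'rV[R]_d) : R :=
  \prod_(i | z 0 i != 0) (`|z 0 i| `^ (d1 z)%:R^-1).

(* Main.v *)
(* Write a, b for the numbers of nonzero and zero coordinates of z. By symmetry z >= 0,
   supported on a set D of a coordinates. The gain |z|_1 - mu_eps(z) is the limit rate of
   (number of open edges collected in the directions of D) - (steps spent sideways)
   - 2 (steps backwards) along the best path.
   A weighted first-moment count of the sequences of open edges visited by a path shows that
   the gain is O(eps^(1/a)) and that, up to o(eps^(1/a)), it is realised by sequences which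
   increase strictly in every coordinate of D. Replace every edge by a box of k_i edges in
   each direction i of D, and call a box open if it contains an open edge: this turns
   parameter p' into p = 1 - (1 - p')^(prod k_i), direction z' into z'/k, and a strictly
   increasing sequence of open boxes lifts to a path of the fine lattice with the same gain.
   Hence, for all z and z' supported on D and all small e,
     rate(e', z') / (gamma(z') e'^(1/a)) >= rate(e, z) / (gamma(z) e^(1/a)) - o(1)
   once e' is small enough depending on e. Applied in both directions, this forces the
   normalized rate to converge as eps -> 0 to a limit which depends only on a and b. *)
Require Import Defs.
From HB Require Import structures.
From mathcomp Require Import all_boot all_order all_algebra.
From mathcomp Require Import all_classical all_reals all_analysis.
From mathcomp Require Import measurable_realfun zify ring lra.
Set Implicit Arguments. Unset Strict Implicit. Unset Printing Implicit Defensive.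
Import Order.TTheory GRing.Theory Num.Theory.
Import numFieldNormedType.Exports.
Local Open Scope classical_set_scope.
Local Open Scope ring_scope.

(** * Finite-volume expectations *)

(** The spaces [P eps] for different [eps] are unrelated, whereas coarse graining compares two
    parameters. All comparisons are therefore made between finite expectations that depend on the
    parameter alone; the given law enters once, when the integral of the passage time is identified
    with [mean_time]. Strict increase matters because the open edge of a box sits at an uncontrolled
    place: two boxes are joined by forward moves only if the second lies beyond the first in every
    direction of D. Gaps violating this are marked in the count by a factor [th]. Any constant [th]
    is affordable once r = p^(1/a) is small, since the sum over gaps in one direction is of order
    1/r and the bad values contribute only O(th). The limit is never constructed explicitly: a
    bounded F with F(e') >= F(e) - delta, for all small e and all e' small depending on e, has equal
    lower and upper limits at 0. *)

Definition add_open (E : eqType) (c : E -> bool) (e : E) : E -> bool :=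
  fun e' => (e' == e) || c e'.

(* Expectation of [phi] when the edges of [s] are added to [c] independently with
   probability [p]; no edge outside [s] is resampled. *)
Fixpoint Ex (R : realType) (E : eqType) (p : R) (s : seq E)
    (phi : (E -> bool) -> R) (c : E -> bool) : R :=
  if s is e :: s' then p * Ex p s' phi (add_open c e) + (1 - p) * Ex p s' phi c
  else phi c.

Definition closed_config (E : Type) : E -> bool := fun _ => false.

Definition antitone_config (R : realType) (E : eqType) (phi : (E -> bool) -> R) :=
  forall c c' : E -> bool, (forall e, c e -> c' e) -> phi c' <= phi c.

Section ExTheory.
Context {R : realType} {E : eqType}.
Implicit Types (p : R) (s : seq E) (phi psi : (E -> bool) -> R) (c : E -> bool).

Lemma addC_config c e f : add_open (add_open c e) f = add_open (add_open c f) e.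
Proof. by apply/funext => x; rewrite /add_open orbCA. Qed.

Lemma add_id c e : add_open (add_open c e) e = add_open c e.
Proof. by apply/funext => x; rewrite /add_open orbA orbb. Qed.

Lemma Ex_le p s phi psi c : 0 <= p <= 1 -> (forall c, phi c <= psi c) ->
  Ex p s phi c <= Ex p s psi c.
Proof.
move=> /andP[p0 p1] h; elim: s c => [|e s IH] c /=; first exact: h.
by apply: lerD; apply: ler_wpM2l => //; rewrite subr_ge0.
Qed.

Lemma Ex_le_support p s phi psi c : 0 <= p <= 1 ->
  (forall c', (forall e, c' e -> c e || (e \in s)) -> phi c' <= psi c') ->
  Ex p s phi c <= Ex p s psi c.
Proof.
move=> /andP[p0 p1]; elim: s c => [|e s IH] c h /=.
  by apply: h => e ->.
apply: lerD; apply: ler_wpM2l; rewrite ?subr_ge0 //; apply: IH => c' hc'; apply: h => f.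
  by rewrite inE orbCA orbA; exact: hc'.
by move=> /hc'; rewrite inE orbCA => ->; rewrite orbT.
Qed.

Lemma Ex_cst p s (a : R) c : Ex p s (fun=> a) c = a.
Proof. by elim: s c => //= e s IH c; rewrite !IH; ring. Qed.

Lemma ExD p s phi psi c :
  Ex p s (fun c => phi c + psi c) c = Ex p s phi c + Ex p s psi c.
Proof. by elim: s c => //= e s IH c; rewrite !IH; ring. Qed.

Lemma ExZ p s a phi c : Ex p s (fun c => a * phi c) c = a * Ex p s phi c.
Proof. by elim: s c => //= e s IH c; rewrite !IH; ring. Qed.

Lemma Ex_sum (I : Type) (r : seq I) p s (F : I -> (E -> bool) -> R) c :
  Ex p s (fun c => \sum_(i <- r) F i c) c = \sum_(i <- r) Ex p s (F i) c.
Proof.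
elim: s c => //= e s IH c.
by rewrite !IH !mulr_sumr -big_split.
Qed.

Lemma Ex_cat p s t phi c : Ex p (s ++ t) phi c = Ex p s (Ex p t phi) c.
Proof. by elim: s c => //= e s IH c; rewrite !IH. Qed.

Lemma Ex_catCA p s1 s2 s3 phi c :
  Ex p (s1 ++ s2 ++ s3) phi c = Ex p (s2 ++ s1 ++ s3) phi c.
Proof.
have H1 e s phi' c' : Ex p (e :: s) phi' c' = Ex p (s ++ [:: e]) phi' c'.
  by elim: s c' => //= f s IH c'; rewrite -!IH /= (addC_config c' e f); ring.
elim: s1 c => //= e s1 IH c; rewrite !IH.
have -> : p * Ex p (s2 ++ s1 ++ s3) phi (add_open c e) +
    (1 - p) * Ex p (s2 ++ s1 ++ s3) phi c = Ex p (e :: s2 ++ s1 ++ s3) phi c by [].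
rewrite -cat_cons Ex_cat H1 -Ex_cat -!catA cat1s; by [].
Qed.

Lemma Ex_perm p s t phi c : perm_eq s t -> Ex p s phi c = Ex p t phi c.
Proof.
move=> st; apply: (@catCA_perm_ind _ (fun u => Ex p s phi c = Ex p u phi c)
  _ s t st erefl) => s1 s2 s3 ->; exact: Ex_catCA.
Qed.

Lemma Ex_antitone_config p s phi c c' : 0 <= p <= 1 -> antitone_config phi ->
  (forall e, c e -> c' e) -> Ex p s phi c' <= Ex p s phi c.
Proof.
move=> /andP[p0 p1] h; elim: s c c' => [|e s IH] c c' cc' /=; first exact: h.
apply: lerD; apply: ler_wpM2l; rewrite ?subr_ge0 //; apply: IH => // f.
by rewrite /add_open => /orP[->//|/cc' ->]; rewrite orbT.
Qed.

Lemma Ex_cat_le p s t phi c : 0 <= p <= 1 -> antitone_config phi ->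
  Ex p (s ++ t) phi c <= Ex p t phi c.
Proof.
move=> p01 h; elim: s c => //= e s IH c.
have [p0 p1] := andP p01.
apply: (@le_trans _ _ (p * Ex p t phi c + (1 - p) * Ex p t phi c)); last lra.
apply: lerD; apply: ler_wpM2l; rewrite ?subr_ge0 //.
apply: (le_trans (IH _)); apply: Ex_antitone_config => // f fc.
by rewrite /add_open fc orbT.
Qed.

Lemma Ex_subset_le p s t phi c : 0 <= p <= 1 -> antitone_config phi ->
  uniq s -> uniq t -> {subset s <= t} -> Ex p t phi c <= Ex p s phi c.
Proof.
move=> p01 h us ut st.
have -> : Ex p t phi c = Ex p ([seq x <- t | x \notin s] ++ s) phi c.
  apply: Ex_perm; apply: uniq_perm => //.
    rewrite cat_uniq filter_uniq //= us andbT.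
    by apply/hasPn => x xs; rewrite mem_filter xs.
  move=> x; rewrite mem_cat mem_filter; case: (boolP (x \in s)) => [/st ->//|].
  by rewrite orbF.
exact: Ex_cat_le.
Qed.

Lemma Ex_antitone_prob p p' s phi c : 0 <= p -> p <= p' -> p' <= 1 ->
  antitone_config phi -> Ex p' s phi c <= Ex p s phi c.
Proof.
move=> p0 pp' p1 h; elim: s c => //= e s IH c.
have h1 : Ex p s phi (add_open c e) <= Ex p s phi c.
  apply: Ex_antitone_config => //; last by move=> f fc; rewrite /add_open fc orbT.
  by rewrite p0 (le_trans pp').
have h2 := IH (add_open c e); have h3 := IH c.
nra.
Qed.

(** The expectation is computed exactly, from any starting configuration: an edge of [u] contributes
    1 if already open, [p] if still to be sampled, 0 otherwise. *)
Lemma Ex_open_le p s (u : seq E) : 0 <= p <= 1 -> uniq s -> uniq u ->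
  Ex p s (fun c => (all c u)%:R) (@closed_config E) <= p ^+ size u.
Proof.
move=> /andP[p0 p1] us uu.
have key c : Ex p s (fun c => (all c u)%:R) c =
    \prod_(x <- u) (if c x then 1 else if x \in s then p else 0).
  elim: s us c => [|e s IH] us c /=.
    elim: u {uu} => [|x u IHu] /=; first by rewrite big_nil.
    by rewrite big_cons -IHu; case: (c x); rewrite ?mul1r ?mul0r.
  have [es {}us] := andP us; rewrite !{}IH //.
  have eqout b : e \notin b ->
      \prod_(x <- b) (if add_open c e x then 1 else if x \in s then p else 0) =
      \prod_(x <- b) (if c x then 1 else if x \in e :: s then p else 0) /\
      \prod_(x <- b) (if c x then 1 else if x \in s then p else 0) =
      \prod_(x <- b) (if c x then 1 else if x \in e :: s then p else 0).
    move=> eb; split; apply: eq_big_seq => x xb.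
      rewrite /add_open inE; case: eqP => //= xe; first by rewrite xe (negPf eb) in xb.
    by rewrite inE; case: eqP => //= xe; rewrite xe (negPf eb) in xb.
  have [eu|eu] := boolP (e \in u); last first.
    by have [-> ->] := eqout u eu; ring.
  rewrite !(big_rem e eu) /= /add_open eqxx /= (negPf es) inE eqxx /=.
  have [|h1 h2] := eqout (rem e u); first by rewrite mem_rem_uniqF.
  rewrite h1 h2; case: (c e); ring.
rewrite key.
have -> : p ^+ size u = \prod_(x <- u) p.
  by rewrite big_const_seq count_predT iter_mulr_1.
apply: ler_prod => x _; rewrite /closed_config.
by case: ifP => _; rewrite ?lexx ?p0.
Qed.

End ExTheory.

Lemma Ex_map (R : realType) (E F : eqType) (f : E -> F) (p : R) s phi c :
  injective f ->
  Ex p (map f s) (fun c => phi (c \o f)) c = Ex p s phi (c \o f).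
Proof.
move=> fi; elim: s c => //= e s IH c; rewrite !IH; congr (_ * Ex _ _ _ _ + _).
by apply/funext => x; rewrite /add_open /= (inj_eq fi).
Qed.

(** Disjoint cells are sampled independently and a cell of [K] edges stays closed with probability
    [(1 - p) ^+ K], so the coarse configuration is again a product of Bernoulli variables. *)
Lemma Ex_coarse (R : realType) (E F : eqType) (cell : E -> seq F) (K : nat)
    (p : R) (s : seq E) phi c :
  (forall e, size (cell e) = K) ->
  (forall e e' x, x \in cell e -> x \in cell e' -> e = e') ->
  Ex p (flatten (map cell s)) (fun c => phi (fun e => has c (cell e))) c =
  Ex (1 - (1 - p) ^+ K) s phi (fun e => has c (cell e)).
Proof.
move=> szK disj.
set co := fun c e => has c (cell e).
have coadd c' x e : x \in cell e -> co (add_open c' x) = add_open (co c') e.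
  move=> xe; apply/funext => e'; rewrite /co /add_open.
  have [->|ee'] /= := eqVneq e' e.
    by apply/hasP; exists x => //; rewrite eqxx.
  apply: eq_in_has => y ye'; case: eqP => //= yx.
  by move: ye'; rewrite yx => /(disj _ _ _ xe) h; rewrite h eqxx in ee'.
(* Opening any edge of the cell of [e] has the same coarse effect, so sampling a part [t] of the
   cell is one Bernoulli trial for [e]. *)
have one e t H c' : {subset t <= cell e} ->
    Ex p t (fun c => H (co c)) c' =
    (1 - (1 - p) ^+ size t) * H (add_open (co c') e) + (1 - p) ^+ size t * H (co c').
  elim: t c' => [|x t IH] c' sub /=; first by rewrite expr0; ring.
  have sub' : {subset t <= cell e} by move=> y yt; apply: sub; rewrite inE yt orbT.
  rewrite !IH // (@coadd _ _ e) ?sub ?mem_head // add_id exprS; ring.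
elim: s c => //= e s IH c; rewrite Ex_cat.
have -> : Ex p (flatten [seq cell i | i <- s]) (fun c0 => phi (co c0)) =
   (fun c => Ex (1 - (1 - p) ^+ K) s phi (co c)).
  by apply/funext => c'; rewrite IH.
by rewrite (@one e _ (Ex (1 - (1 - p) ^+ K) s phi)) // szK opprB addrCA subrr addr0.
Qed.

(** * Passage times and chains of open edges *)

(* [lia] does not recognise matrix entries as atoms; they are generalized first. *)
Ltac mlia :=
  repeat match goal with
  | |- context [@fun_of_matrix ?T ?m ?n ?x ?a ?b] =>
      lazymatch T with int => fail | _ =>
      change (@fun_of_matrix T m n x a b) with (@fun_of_matrix int m n x a b) in * end
  | _ : context [@fun_of_matrix ?T ?m ?n ?x ?a ?b] |- _ =>
      lazymatch T with int => fail | _ =>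
      change (@fun_of_matrix T m n x a b) with (@fun_of_matrix int m n x a b) in * end
  end;
  repeat match goal with
  | |- context [@fun_of_matrix int ?m ?n ?x ?a ?b] =>
      let z := fresh "z" in set (z := @fun_of_matrix int m n x a b) in *; clearbody z
  | _ : context [@fun_of_matrix int ?m ?n ?x ?a ?b] |- _ =>
      let z := fresh "z" in set (z := @fun_of_matrix int m n x a b) in *; clearbody z
  end; lia.

Definition nrm d (x : vertex d) : nat := (\sum_i `|(x 0 i)%R|)%N.
Arguments nrm {d} x%_R.

Section Norm.
Context {d : nat}.
Implicit Types (x y : vertex d) (s : step d).

Lemma nrm0 : nrm (0 : vertex d) = 0%N.
Proof. by rewrite /nrm big1 // => i _; rewrite mxE. Qed.

Lemma nrmN x : nrm (- x) = nrm x.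
Proof. by apply: eq_bigr => i _; rewrite mxE abszN. Qed.

Lemma nrmB x y : nrm (x - y) = nrm (y - x).
Proof. by rewrite -nrmN opprB. Qed.

Lemma nrmD x y : (nrm (x + y) <= nrm x + nrm y)%N.
Proof. by rewrite /nrm -big_split /=; apply: leq_sum => i _; rewrite mxE; mlia. Qed.

Lemma nrm_tri x y u : (nrm (x - y) <= nrm (x - u) + nrm (u - y))%N.
Proof. by rewrite (_ : x - y = (x - u) + (u - y)) ?nrmD // addrA subrK. Qed.

Lemma nrm_unitv (i : 'I_d) : nrm (unitv i) = 1%N.
Proof.
rewrite /nrm (bigD1 i) //= big1 => [|j ji]; first by rewrite mxE !eqxx.
by rewrite mxE (negPf ji) andbF.
Qed.

Lemma nrm_step x s : nrm (step_next x s - x) = 1%N.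
Proof.
by rewrite /step_next; case: ifP => _; rewrite addrAC subrr add0r ?nrmN nrm_unitv.
Qed.

Lemma nrm_eq0 x : nrm x = 0%N -> x = 0.
Proof.
move/eqP; rewrite sum_nat_eq0 => /forallP h; apply/rowP => i; rewrite mxE.
by apply/eqP; rewrite -absz_eq0; apply: (implyP (h i)).
Qed.

Lemma straight_path x y : exists p, path_end x p = y /\ size p = nrm (y - x).
Proof.
move: {2}(nrm _) (erefl (nrm (y - x))) => n; elim: n x => [|n IH] x xy.
  by exists [::]; split; rewrite ?xy //= -[x]addr0 -(nrm_eq0 xy) addrC subrK.
have [i xi] : exists i, (y - x) 0 i != 0.
  apply/existsP; rewrite -negb_forall; apply/negP => /forallP h.
  suff: y - x = 0 by move=> e; rewrite e nrm0 in xy.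
  by apply/rowP => i; rewrite [RHS]mxE (eqP (h i)).
pose s := (i, 0 < (y - x) 0 i) : step d.
have h : nrm (y - step_next x s) = n.
  apply: succn_inj; rewrite -xy /nrm (bigD1 i) //= [RHS](bigD1 i) //= -addSn.
  congr (_ + _)%N; last first.
    apply: eq_bigr => j ji; rewrite /step_next /=.
    by case: ifP => _; rewrite !mxE (negPf ji) andbF /= ?mulr0n; mlia.
  move: xi; rewrite /step_next /=; case: ifP; rewrite !mxE !eqxx /=; mlia.
have [p [pe ps]] := IH _ h.
by exists (s :: p); split => //=; rewrite ps h xy.
Qed.

End Norm.

Fixpoint nclosed d (c : edge d -> bool) (v : vertex d) (p : seq (step d)) : nat :=
  if p is s :: p' then (~~ c (step_edge v s) + nclosed c (step_next v s) p')%N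
  else 0%N.

Lemma passage_time_ex d (c : edge d -> bool) (x y : vertex d) :
  exists n, `[< exists p, path_end x p = y /\ nclosed c x p = n >].
Proof.
have [p [px _]] := straight_path x y.
by exists (nclosed c x p); apply/asboolP; exists p.
Qed.

(** A minimum of natural numbers, so that an optimal path exists for every configuration. *)
Definition passage_time d (c : edge d -> bool) (x y : vertex d) : nat :=
  ex_minn (passage_time_ex c x y).

Section PassageTime.
Context {d : nat}.
Implicit Types (x y v : vertex d) (s : step d) (c : edge d -> bool).

Lemma passage_time_le c x p : (passage_time c x (path_end x p) <= nclosed c x p)%N.
Proof.
rewrite /passage_time; case: ex_minnP => m _; apply.
by apply/asboolP; exists p.
Qed.

Lemma passage_time_path c x y :
  exists2 p, path_end x p = y & nclosed c x p = passage_time c x y.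
Proof.
rewrite /passage_time; case: ex_minnP => m /asboolP[p [pe pc]] _.
by exists p.
Qed.

Lemma path_end_cat x p q : path_end x (p ++ q) = path_end (path_end x p) q.
Proof. by elim: p x => /=. Qed.

Lemma nclosed_cat c x p q :
  nclosed c x (p ++ q) = (nclosed c x p + nclosed c (path_end x p) q)%N.
Proof. by elim: p x => //= s p IH x; rewrite IH addnA. Qed.

Lemma nclosed_size c x p : (nclosed c x p <= size p)%N.
Proof. by elim: p x => //= s p IH x; exact: (leq_add (leq_b1 _) (IH _)). Qed.

Lemma passage_time_nrm c x y : (passage_time c x y <= nrm (y - x))%N.
Proof.
have [p [<- <-]] := straight_path x y.
exact: leq_trans (passage_time_le _ _ _) (nclosed_size _ _ _).
Qed.

Lemma passage_time_tri c x y u :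
  (passage_time c x y <= passage_time c x u + passage_time c u y)%N.
Proof.
have [p pu <-] := passage_time_path c x u.
have [q qy <-] := passage_time_path c u y.
apply: leq_trans (_ : passage_time c x (path_end x (p ++ q)) <= _)%N.
  by rewrite path_end_cat pu qy.
by apply: leq_trans (passage_time_le _ _ _) _; rewrite nclosed_cat pu.
Qed.

Lemma passage_time_antitone c c' x y : (forall e, c e -> c' e) ->
  (passage_time c' x y <= passage_time c x y)%N.
Proof.
move=> cc'; have [p pe <-] := passage_time_path c x y; rewrite -pe.
apply: leq_trans (passage_time_le _ _ _) _.
elim: p x {pe} => //= s p IH x; apply: leq_add; last exact: IH.
by case: (boolP (c _)) => [/cc' ->//|]; case: (c' _).
Qed.

End PassageTime.

(** The open edges crossed by a path, with their orientations. [chain_cost] charges each gap its l1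
    length, as if nothing open were met there, so the geometry of the path between open edges is
    forgotten. *)
Definition chain d := seq (vertex d * step d).

Fixpoint chain_cost d (x : vertex d) (os : chain d) (y : vertex d) : nat :=
  if os is o :: os' then
    (nrm (o.1 - x) + chain_cost (step_next o.1 o.2) os' y)%N
  else nrm (y - x).

Definition chain_edge d (o : vertex d * step d) : edge d := step_edge o.1 o.2.

Section Chains.
Context {d : nat}.
Implicit Types (x y v : vertex d) (s : step d) (c : edge d -> bool) (os : chain d).

Lemma chain_cost_tri x x' os y :
  (chain_cost x os y <= nrm (x' - x) + chain_cost x' os y)%N.
Proof.
case: os => [|o os] /=; first by rewrite addnC nrm_tri.
by rewrite addnA leq_add2r addnC nrm_tri.
Qed.

Lemma chain_cost_cat x os o os' y : chain_cost x (os ++ o :: os') y =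
  (chain_cost x os o.1 + chain_cost (step_next o.1 o.2) os' y)%N.
Proof. by elim: os x => //= o' os IH x; rewrite IH addnA. Qed.

Lemma passage_time_chain_le c x os y : all c (map (@chain_edge d) os) ->
  (passage_time c x y <= chain_cost x os y)%N.
Proof.
elim: os x => [| o os IH] x /=; first by move=> _; exact: passage_time_nrm.
move=> /andP[co /IH h].
apply: leq_trans (passage_time_tri c x y o.1) _.
apply: leq_add; first exact: passage_time_nrm.
apply: leq_trans (passage_time_tri c _ _ (step_next o.1 o.2)) _.
rewrite -[leqRHS]add0n; apply: leq_add; last exact: h.
by apply: leq_trans (passage_time_le c o.1 [:: o.2]) _; rewrite /= [step_edge _ _]/(chain_edge o) co.
Qed.

Lemma chain_edge_inj (o o' : vertex d * step d) : chain_edge o = chain_edge o' ->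
  (o.1 = o'.1 /\ step_next o.1 o.2 = step_next o'.1 o'.2) \/
  (o.1 = step_next o'.1 o'.2 /\ step_next o.1 o.2 = o'.1).
Proof.
case: o o' => [x [i b]] [x' [i' b']]; rewrite /chain_edge /step_edge /step_next /=.
case: b; case: b' => -[e ii]; subst i'.
- by left; rewrite e.
- by right; rewrite e subrK.
- by right; rewrite -e subrK.
- by left; rewrite (addIr _ e).
Qed.

(** A repeated edge closes a loop. With equal orientations, the second passage and all that lies
    between are cut; with opposite ones both passages go, since the second ends where the first
    began. Distinct edges are what makes the probability of an open chain a power of [p]. *)
Lemma shorten_chain x os y : ~~ uniq (map (@chain_edge d) os) ->
  exists os', [/\ (size os' < size os)%N, {subset os' <= os} &
                  (chain_cost x os' y <= chain_cost x os y)%N].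
Proof.
elim: os x => //= o os IH x; rewrite negb_and negbK => /orP[|h].
  move=> /mapP[ o2 o2s eo].
  have [r1 [r2 ->]] : exists r1 r2, os = r1 ++ o2 :: r2.
    by case/splitPr: o2s => r1 r2; exists r1, r2.
  have [[e1 e2]|[e1 e2]] := chain_edge_inj eo.
    exists (o :: r2); split => /=; first by rewrite size_cat /=; lia.
      by move=> z; rewrite !inE mem_cat inE => /orP[->//|->]; rewrite !orbT.
    by rewrite leq_add2l chain_cost_cat e2 leq_addl.
  exists r2; split => /=; first by rewrite size_cat /=; lia.
    by move=> z zs; rewrite !inE mem_cat inE zs !orbT.
  rewrite chain_cost_cat -e1; apply: leq_trans (chain_cost_tri x o.1 r2 y) _.
  by rewrite leq_add2l leq_addl.
have [ os' [h1 h2 h3]] := IH (step_next o.1 o.2) h.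
exists (o :: os'); split => //=; last by rewrite leq_add2l.
by move=> z; rewrite !inE => /orP[->//|/h2 ->]; rewrite orbT.
Qed.

Lemma passage_time_chain c x y : exists os,
  [/\ all c (map (@chain_edge d) os), uniq (map (@chain_edge d) os) &
      (chain_cost x os y <= passage_time c x y)%N].
Proof.
suff [ os [os1 os2]] : exists os, all c (map (@chain_edge d) os) /\
    (chain_cost x os y <= passage_time c x y)%N.
  move: {2}(size os) (leqnn (size os)) => n; elim: n os os1 os2 => [|n IH] os os1 os2 sz.
    by exists os; split => //; case: os sz {os1 os2}.
  have [uos | /(shorten_chain x y)[ os' [h1 h2 h3]]] :=
    boolP (uniq (map (@chain_edge d) os)); first by exists os.
  apply: (IH os').
  - by apply/allP => e /mapP[ o /h2 oos ->]; apply: (allP os1); exact: map_f.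
  - exact: leq_trans h3 os2.
  - by rewrite -ltnS; apply: leq_trans h1 _.
have [p pe <-] := passage_time_path c x y; rewrite -{}pe.
elim: p x => [|s p IH] x /=; first by exists [::]; rewrite /= subrr nrm0.
have [ os [os1 os2]] := IH (step_next x s).
case: (boolP (c (step_edge x s))) => cs /=.
  exists ((x, s) :: os); split; first by rewrite /= os1 andbT.
  by rewrite /= subrr nrm0 !add0n.
exists os; split => //; apply: leq_trans (chain_cost_tri x (step_next x s) os _) _.
by rewrite nrm_step leq_add2l.
Qed.

End Chains.

(** * Mean passage times *)

(* Edges outside [s] are closed, so the expectations decrease in [s] and the
   infimum is the limit along any exhaustion of the edge set. *)
Definition mean_time (R : realType) d (p : R) (x : vertex d) : R :=
  inf [set Ex p s (fun c => (passage_time c 0 x)%:R) (@closed_config (edge d))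
      | s in [set s | uniq s]].

Section MeanTime.
Context {R : realType} {d : nat}.
Implicit Types (p : R) (x y v : vertex d) (s : seq (edge d)) (c : edge d -> bool).

Lemma passage_time_antitone_config x y :
  antitone_config (fun c => (passage_time c x y)%:R : R).
Proof. by move=> c c' cc'; rewrite ler_nat; exact: passage_time_antitone. Qed.

Lemma Ex_passage_time_ge0 p s x y c : 0 <= p <= 1 ->
  0 <= Ex p s (fun c => (passage_time c x y)%:R) c.
Proof.
move=> p01; rewrite -(Ex_cst p s 0 c); exact: Ex_le.
Qed.

Lemma mean_time_le p s x : 0 <= p <= 1 -> uniq s ->
  mean_time p x <= Ex p s (fun c => (passage_time c 0 x)%:R) (@closed_config _).
Proof.
move=> p01 us; apply: ge_inf; last by exists s.
by exists 0 => _ [t _ <-]; exact: Ex_passage_time_ge0.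
Qed.

Lemma mean_time_ge p x (m : R) :
  (forall s, uniq s ->
    m <= Ex p s (fun c => (passage_time c 0 x)%:R) (@closed_config _)) ->
  m <= mean_time p x.
Proof.
move=> h; apply: lb_le_inf; first by exists (Ex p [::] (fun c => (passage_time c 0 x)%:R) (@closed_config _)), [::].
by move=> _ [t ut <-]; exact: h.
Qed.

Lemma mean_time_ge0 p x : 0 <= p <= 1 -> 0 <= mean_time p x.
Proof. by move=> p01; apply: mean_time_ge => s _; exact: Ex_passage_time_ge0. Qed.

Lemma mean_time_nrm p x : 0 <= p <= 1 -> mean_time p x <= (nrm x)%:R.
Proof.
move=> p01; apply: le_trans (mean_time_le x p01 (erefl : uniq [::])) _ => /=.
by rewrite ler_nat -{2}[x]subr0; exact: passage_time_nrm.
Qed.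

Lemma mean_time_antitone p p' x : 0 <= p -> p <= p' -> p' <= 1 ->
  mean_time p' x <= mean_time p x.
Proof.
move=> p0 pp' p1; apply: mean_time_ge => s us.
apply: le_trans (mean_time_le x _ us) _; first by rewrite (le_trans p0).
by apply: Ex_antitone_prob => //; exact: passage_time_antitone_config.
Qed.

Lemma passage_time_transport (f : vertex d -> vertex d) (g : edge d -> edge d) c x y :
  (forall v (s : step d), exists t, step_next (f v) t = f (step_next v s) /\
                         step_edge (f v) t = g (step_edge v s)) ->
  (passage_time c (f x) (f y) <= passage_time (c \o g) x y)%N.
Proof.
move=> H; have [q qe <-] := passage_time_path (c \o g) x y; rewrite -{y}qe.
have [q' [<- <-]] : exists q', path_end (f x) q' = f (path_end x q) /\
    nclosed c (f x) q' = nclosed (c \o g) x q.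
  elim: q x => [|u q IH] x; first by exists [::].
  have [t [tn te]] := H x u; have [q' [qe qc]] := IH (step_next x u).
  by exists (t :: q') => /=; rewrite tn te qe qc.
exact: passage_time_le.
Qed.

Lemma mean_time_automorphism (f : vertex d -> vertex d) (g : edge d -> edge d) p x :
  0 <= p <= 1 -> injective g -> f 0 = 0 ->
  (forall v (s : step d), exists t, step_next (f v) t = f (step_next v s) /\
                         step_edge (f v) t = g (step_edge v s)) ->
  mean_time p (f x) <= mean_time p x.
Proof.
move=> p01 gi f0 H; apply: mean_time_ge => s us.
have ugs : uniq (map g s) by rewrite map_inj_uniq.
apply: le_trans (mean_time_le _ p01 ugs) _.
apply: (@le_trans _ _ (Ex p (map g s)
  (fun c => (passage_time (c \o g) 0 x)%:R) (@closed_config _))).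
  by apply: Ex_le => // c; rewrite ler_nat -{1}f0; exact: passage_time_transport.
by rewrite (Ex_map _ _ (fun c => (passage_time c 0 x)%:R)).
Qed.

(** The triangle inequality, tested on the union of one finite edge set with a translate of the
    other; sampling the extra edges only lowers both expectations. *)
Lemma mean_timeD p x y : 0 <= p <= 1 ->
  mean_time p (x + y) <= mean_time p x + mean_time p y.
Proof.
move=> p01; rewrite -lerBlDl; apply: mean_time_ge => s2 us2.
rewrite lerBlDl -lerBlDr; apply: mean_time_ge => s1 us1; rewrite lerBlDr.
pose sh (e : edge d) : edge d := (e.1 + x, e.2).
have shi : injective sh by move=> [e i] [e' i'] [/addIr -> ->].
pose s := undup (s1 ++ map sh s2); have us : uniq s by exact: undup_uniq.
apply: le_trans (mean_time_le _ p01 us) _.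
apply: (@le_trans _ _ (Ex p s (fun c => (passage_time c 0 x)%:R + (passage_time c x (x + y))%:R)
   (@closed_config _))).
  by apply: Ex_le => // c; rewrite -natrD ler_nat; exact: passage_time_tri.
rewrite ExD; apply: lerD.
  apply: Ex_subset_le => //; first exact: passage_time_antitone_config.
  by move=> e es; rewrite mem_undup mem_cat es.
apply: (@le_trans _ _ (Ex p (map sh s2) (fun c => (passage_time c x (x + y))%:R)
   (@closed_config _))).
  apply: Ex_subset_le => //; first exact: passage_time_antitone_config.
    by rewrite map_inj_uniq.
  by move=> e es; rewrite mem_undup mem_cat es orbT.
apply: (@le_trans _ _ (Ex p (map sh s2)
  (fun c => (passage_time (c \o sh) 0 y)%:R) (@closed_config _))).
  apply: Ex_le => // c; rewrite ler_nat.
  rewrite -{1}(add0r x) (addrC x).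
  apply: (@passage_time_transport (fun v => v + x)) => v t.
  exists t; rewrite /sh /step_next /step_edge; case: ifP => _ /=;
    by rewrite addrAC.
by rewrite (Ex_map _ _ (fun c => (passage_time c 0 y)%:R)).
Qed.

Lemma mean_time_nrmB p x y : 0 <= p <= 1 ->
  mean_time p x <= mean_time p y + (nrm (x - y))%:R.
Proof.
move=> p01; rewrite -{1}(subrK y x) addrC; apply: le_trans (mean_timeD _ _ p01) _.
by rewrite lerD2l mean_time_nrm.
Qed.

Definition signed_perm (f : 'I_d -> 'I_d) (sg : 'I_d -> bool) x : vertex d :=
  \row_i (if sg i then - x 0 (f i) else x 0 (f i)).

Lemma mean_time_signed_perm_le p (f g : 'I_d -> 'I_d) sg x : 0 <= p <= 1 ->
  cancel f g -> cancel g f ->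
  mean_time p (signed_perm f sg x) <= mean_time p x.
Proof.
move=> p01 fg gf.
(* An edge is recorded at its lower endpoint; under a reflection this is the image of the upper one,
   hence the subtraction of [unitv]. *)
pose h (e : edge d) : edge d :=
  (if sg (g e.2) then signed_perm f sg e.1 - unitv (g e.2) else signed_perm f sg e.1, g e.2).
have unitE (v : vertex d) j (b : bool) :
    signed_perm f sg (step_next v (j, b)) =
    step_next (signed_perm f sg v) (g j, b (+) sg (g j)).
  apply/rowP => i; rewrite /step_next /= !mxE.
  have ij : (f i == j) = (i == g j).
    by apply/eqP/eqP => [<-|->]; rewrite ?fg ?gf.
  have [e|ne] := eqVneq i (g j).
    rewrite e; case E: (sg (g j)); case: b => /=; rewrite !mxE gf !eqxx E /= ?mulr1n; mlia.
  have ne' : f i == j = false by rewrite ij (negPf ne).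
  by case: (sg (g j)); case: b => /=; case E: (sg i);
    rewrite !mxE ne' (negPf ne) ?E /= ?mulr0n ?oppr0 ?subr0 ?addr0.
apply: (@mean_time_automorphism (signed_perm f sg) h) => //.
- move=> [v i] [v' i']; rewrite /h /= => -[].
  move=> + /(can_inj gf) ii; rewrite -{}ii => e; congr pair.
  have {}e : signed_perm f sg v = signed_perm f sg v'.
    by move: e; case: ifP => // _ /addIr.
  apply/rowP => j; move/rowP: e => /(_ (g j)); rewrite !mxE gf.
  by case: ifP => // _ /oppr_inj.
- by apply/rowP => i; rewrite !mxE oppr0 if_same.
move=> v [j b]; exists (g j, b (+) sg (g j)); rewrite unitE; split => //.
rewrite /h /step_edge /=; case: b => /=; first by case: (sg (g j)).
have -> : v - unitv j = step_next v (j, false) by [].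
rewrite unitE /= /step_next /=.
by case: (sg (g j)) => //=; rewrite addrK.
Qed.

Lemma mean_time_signed_perm p (f g : 'I_d -> 'I_d) sg x : 0 <= p <= 1 ->
  cancel f g -> cancel g f ->
  mean_time p (signed_perm f sg x) = mean_time p x.
Proof.
move=> p01 fg gf; apply/eqP; rewrite eq_le; apply/andP; split.
  exact: mean_time_signed_perm_le fg gf.
suff {1}-> : x = signed_perm g (sg \o g) (signed_perm f sg x).
  exact: mean_time_signed_perm_le gf fg.
by apply/rowP => i; rewrite !mxE /= gf; case: (sg (g i)); rewrite ?opprK.
Qed.

End MeanTime.

(** * Coarse graining *)

(** Only the base point ranges over the box: all edges of a cell share the direction of the coarse
    edge, and distinct coarse edges have disjoint cells. *)
Definition cell d (k : 'I_d -> nat) (e : edge d) : seq (edge d) :=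
  [seq ((\row_j ((k j)%:Z * e.1 0 j + (a j)%:Z), e.2) : edge d)
  | a : {dffun forall j : 'I_d, 'I_(k j)} <- enum {dffun forall j : 'I_d, 'I_(k j)}].

Definition scale d (k : 'I_d -> nat) (x : vertex d) : vertex d :=
  \row_i ((k i)%:Z * x 0 i).

(** A gap of 1 already counts as bad: an edge crossed backwards has its lower endpoint one below the
    point where it is entered. With gaps of at least 2 the lower endpoints increase strictly
    whatever the orientations. *)
Definition bad_gap d (D : pred 'I_d) (g : vertex d) : bool :=
  [exists i, D i && (g 0 i <= 1)].

Fixpoint nbad d (D : pred 'I_d) (v : vertex d) (os : chain d) : nat :=
  if os is o :: os' then
    (bad_gap D (o.1 - v)%R + nbad D (step_next o.1 o.2) os')%N
  else 0%N.

Section Cells.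
Context {d : nat}.
Variable k : 'I_d -> nat.
Implicit Types (e : edge d).

Lemma size_cell e : size (cell k e) = (\prod_i k i)%N.
Proof.
rewrite size_map -cardE card_dep_ffun foldrE big_map enumT.
by apply: eq_bigr => i _; rewrite card_ord.
Qed.

Lemma mem_cell f e : f \in cell k e -> f.2 = e.2 /\
  forall j, (k j)%:Z * e.1 0 j <= f.1 0 j < (k j)%:Z * e.1 0 j + (k j)%:Z.
Proof.
move=> /mapP[a _ ->]; split => // j /=; rewrite mxE; have := ltn_ord (a j).
move: (nat_of_ord (a j)) => {a} a.
by move: (_ * _) => b; lia.
Qed.

Lemma cell_disjoint e e' f : f \in cell k e -> f \in cell k e' -> e = e'.
Proof.
case: e e' => [x i] [x' i'] /mem_cell /= [<- h] /mem_cell /= [<- h'].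
congr pair; apply/rowP => j; have := h j; have := h' j.
move: (x 0 j) (x' 0 j) (f.1 0 j) (k j) => a b c n /andP[? ?] /andP[? ?]; nia.
Qed.

Lemma cell_uniq e : uniq (cell k e).
Proof.
rewrite map_inj_uniq ?enum_uniq // => a b [/rowP ab].
apply/ffunP => j; apply/val_inj => /=; have := ab j; rewrite !mxE => /addrI.
by case.
Qed.

Lemma cells_uniq (s : seq (edge d)) : uniq s -> uniq (flatten (map (cell k) s)).
Proof.
elim: s => //= e s IH /andP[es us]; rewrite cat_uniq cell_uniq IH // andbT.
apply/hasPn => f /flatten_mapP[e' e's fe']; apply/negP => fe.
by rewrite (cell_disjoint fe fe') e's in es.
Qed.

End Cells.

(** * Lifting a coarse chain to the fine lattice *)

Section Transfer.
Context {d : nat}.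
Variables (D : pred 'I_d) (k : 'I_d -> nat) (c : edge d -> bool) (X : vertex d).
Hypothesis k1 : forall i, ~~ D i -> k i = 1%N.
Hypothesis X0 : forall i, ~~ D i -> X 0 i = 0.
Hypothesis Xge0 : forall i, D i -> 0 <= X 0 i.

Let coarse e := has c (cell k e).

Lemma step_nextE (u : vertex d) j b i : step_next u (j, b) 0 i =
  u 0 i + (if i == j then (if b then 1 else -1) else 0).
Proof.
by rewrite /step_next /=; case: b; rewrite !mxE eqxx /=; case: (i == j); rewrite ?mulr1n ?mulr0n ?oppr0.
Qed.

Lemma chain_baseE (u : vertex d) j b i : (chain_edge (u, (j, b))).1 0 i =
  u 0 i - (if (i == j) && ~~ b then 1 else 0).
Proof.
rewrite /chain_edge /step_edge /=; case: b; rewrite ?andbF ?andbT ?subr0 //.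
by rewrite !mxE eqxx /=; case: (i == j).
Qed.

(* [y] is the fine position, [v] the coarse one and [M] the last cell used. The first
   [max] is the credit spent while the coarse chain catches up with [M], the second
   the debt of a chain that overshoots [X] and has to come back. *)
Let pot (y v M : vertex d) i : int :=
  if D i then ((k i)%:Z * X 0 i - y 0 i) - (X 0 i - v 0 i)
    + Num.max 0 (M 0 i - v 0 i) - Num.max 0 (v 0 i - X 0 i + 1) + 1
  else `|y 0 i - v 0 i|.

Lemma nrmZ (x : vertex d) : (nrm x)%:Z = \sum_i `|x 0 i|.
Proof.
by rewrite /nrm (big_morph Posz PoszD (erefl _)); apply: eq_bigr => i _; rewrite abszE.
Qed.

Lemma pot_step (y v M u : vertex d) j b : \sum_i pot y (step_next u (j, b)) M i <=
  \sum_i pot y v M i + (nrm (u - v))%:Z + 1.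
Proof.
have -> : 1%R = \sum_(i < d) (if i == j then 1%R else 0%R) :> int.
  by rewrite -big_mkcond big_pred1_eq.
rewrite nrmZ -!big_split /=; apply: ler_sum => i _.
by rewrite /pot step_nextE !mxE; case: (D i); case: (i == j); case: b; mlia.
Qed.

(** Dropping an edge forfeits a free step, worth 1. After a good gap this is recovered in coordinate
    [i0]: either the chain is not yet beyond [M] and its advance uses up credit, or it has reached
    [X] and its debt grows. *)
Lemma pot_drop (y v M u : vertex d) j b : ~~ bad_gap D (u - v) ->
  ~~ [forall i, D i ==> (M 0 i < (chain_edge (u, (j, b))).1 0 i < X 0 i)] ->
  \sum_i pot y (step_next u (j, b)) M i <= \sum_i pot y v M i + (nrm (u - v))%:Z.
Proof.
move=> nb /forallPn[i0]; rewrite negb_imply => /andP[Di0].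
rewrite chain_baseE => drop.
have {}nb i : D i -> 1 < (u - v) 0 i.
  by move=> Di; rewrite ltNge; apply: contra nb => h; apply/existsP; exists i; rewrite Di.
have -> : (nrm (u - v))%:Z = (nrm (u - v))%:Z + \sum_(i < d) (if i == j then 1%R else 0%R)
     - \sum_(i < d) (if i == i0 then 1%R else 0%R).
  by rewrite -!big_mkcond !big_pred1_eq addrK.
rewrite nrmZ -!sumrN -!big_split /=; apply: ler_sum => i _.
rewrite /pot step_nextE.
case: (boolP (D i)) => [Di|nDi]; last first.
  have -> : (i == i0) = false by apply: contraNF nDi => /eqP ->.
  by rewrite !mxE; case: (i == j); case: b {drop}; mlia.
have := nb _ Di; rewrite !mxE.
case: (eqVneq i i0) => [ii|_]; last by case: (i == j); case: b {drop}; mlia.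
by rewrite ii; move: drop; case: (i0 == j); case: b => /=; mlia.
Qed.

(** The first hypothesis says that [y] has not passed the far corner of the cell [M]. Hence an edge
    in a cell that is strictly larger in all directions of [D] is reached from [y] by moving
    forwards only in these directions. *)
Lemma coarse_transfer_rec os (y v M : vertex d) :
  (forall i, D i -> y 0 i <= (k i)%:Z * (M 0 i + 1)) ->
  (forall i, D i -> M 0 i + 1 <= X 0 i) ->
  all coarse (map (@chain_edge d) os) ->
  (passage_time c y (scale k X))%:Z <=
    (chain_cost v os X)%:Z + (nbad D v os)%:Z + \sum_i pot y v M i.
Proof.
elim: os y v M => [|[u [j b]] os IH] y v M yM MX /=.
  move=> _; apply: (@le_trans _ _ (nrm (scale k X - y))%:Z).
    by rewrite lez_nat; exact: passage_time_nrm.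
  rewrite addr0 !nrmZ -big_split /=; apply: ler_sum => i _.
  rewrite /pot !mxE; case: (boolP (D i)) => [Di|nDi].
    have h1 := yM i Di; have h2 := MX i Di.
    have h3 : (k i)%:Z * (M 0 i + 1) <= (k i)%:Z * X 0 i by exact: ler_wpM2l.
    mlia.
  rewrite X0 // mulr0; mlia.
move=> /andP[oe oall].
set v' := step_next u (j, b).
case: (boolP [forall i, D i ==> (M 0 i < (chain_edge (u, (j, b))).1 0 i < X 0 i)]); last first.
  move=> drop; apply: le_trans (IH y v' M yM MX oall) _.
  case: (boolP (bad_gap D (u - v))) => nb /=.
    have := @pot_step y v M u j b; rewrite -/v'.
    by move: (\sum_i pot y v' M i) (\sum_i pot y v M i) (nrm _) => *; lia.
  have := @pot_drop y v M u j b nb drop; rewrite -/v'.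
  by move: (\sum_i pot y v' M i) (\sum_i pot y v M i) (nrm _) => *; lia.
move=> /forallP keep.
set B := (chain_edge (u, (j, b))).1 in keep.
have {}keep i : D i -> M 0 i < B 0 i < X 0 i by move=> Di; exact: (implyP (keep i)).
have [[x j'] xcell cx] := hasP oe.
have [/= jj xB] := mem_cell xcell.
have jE : (chain_edge (u, (j, b))).2 = j by case: (b).
have {}jj : j' = j by rewrite jj jE.
subst j'.
(* In a direction of [D] the fine path crosses forwards even if the coarse chain crosses backwards.
   In the other directions [k] is 1 and the fine position has to follow the chain, so the
   orientation is kept. *)
pose b' := D j || b.
pose u' := if b' then x else step_next x (j, true).
have u'e : step_edge u' (j, b') = (x, j).
  rewrite /u' /step_edge /=; case: (b') => //=.
  by rewrite /step_next /= addrK.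
set y' := step_next u' (j, b').
apply: (@le_trans _ _ ((nrm (u' - y))%:Z + (passage_time c y' (scale k X))%:Z)).
  rewrite -PoszD lez_nat; apply: leq_trans (passage_time_tri c y _ u') _.
  apply: leq_add; first exact: passage_time_nrm.
  apply: leq_trans (passage_time_tri c u' _ y') _.
  rewrite -[leqRHS]add0n leq_add2r.
  by apply: leq_trans (passage_time_le c u' [:: (j, b')]) _; rewrite /= u'e cx.
have u'E i : u' 0 i = x 0 i + (if (i == j) && ~~ b' then 1 else 0).
  by rewrite /u'; case: (b'); rewrite ?step_nextE ?andbT ?andbF ?addr0.
have yE i : y' 0 i = x 0 i + (if (i == j) && b' then 1 else 0).
  by rewrite /y' step_nextE u'E; case: (b'); case: (i == j) => /=; mlia.
have yM' i : D i -> y' 0 i <= (k i)%:Z * (B 0 i + 1).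
  move=> Di; have := xB i; rewrite yE -/B mulrDr mulr1 => /andP[_].
  by move: ((k i)%:Z * _) => z; case: ifP => _; mlia.
have MX' i : D i -> B 0 i + 1 <= X 0 i by move=> /keep /andP[_]; mlia.
have := IH y' v' B yM' MX' oall.
suff : (nrm (u' - y))%:Z + \sum_i pot y' v' B i <=
       (nrm (u - v))%:Z + \sum_i pot y v M i.
  move: (\sum_i pot y' v' B i) (\sum_i pot y v M i) (nrm (u' - y)) (nrm (u - v)) => *.
  by move: (bad_gap _ _) => bg; lia.
rewrite !nrmZ -!big_split /=; apply: ler_sum => i _.
rewrite [(u' - y) 0 i]mxE [(- y) 0 i]mxE [(u - v) 0 i]mxE [(- v) 0 i]mxE.
rewrite /pot yE u'E /v' step_nextE /B chain_baseE.
case: (boolP (D i)) => [Di|nDi].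
  have h1 := yM i Di.
  have := keep i Di; rewrite /B chain_baseE => h2.
  have h3 : (k i)%:Z * (M 0 i + 1) <= (k i)%:Z * B 0 i.
    by apply: ler_wpM2l => //; have := keep i Di; mlia.
  have /andP[h4 _] := xB i; rewrite -/B in h4.
  have h5 : (i == j) && ~~ b' = false.
    by rewrite /b'; case: eqP => // <-; rewrite Di.
  rewrite h5; have h6 : (i == j) && b' = (i == j).
    by rewrite /b'; case: eqP => // <-; rewrite Di.
  rewrite h6; move: h1 h3 h4; rewrite addr0.
  move=> h1 h3 h4.
  by move: h2; clear -h1 h3 h4; case: (i == j); case: (b) => /=; mlia.
have := xB i; rewrite (k1 nDi) mul1r -/B /B chain_baseE => h.
have h5 : (i == j) && b' = (i == j) && b.
  by rewrite /b'; case: eqP => // <-; rewrite (negPf nDi).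
have h6 : (i == j) && ~~ b' = (i == j) && ~~ b.
  by rewrite /b'; case: eqP => // <-; rewrite (negPf nDi).
by rewrite h5 h6; move: h; case: (i == j); case: (b) => /=; mlia.
Qed.

(* The fine geodesic follows the subsequence of coarse open edges whose cells
   increase strictly in the directions of [D]; a dropped edge is paid for by a
   bad gap or by the backtracking of the coarse chain. *)
Lemma coarse_transfer os : all coarse (map (@chain_edge d) os) ->
  (passage_time c 0%R (scale k X) + nrm X <=
   nrm (scale k X) + chain_cost 0%R os X + nbad D 0%R os + #|D|)%N.
Proof.
move=> oall.
(* Index -1 in every coordinate: the origin is the far corner of this cell, and every cell of
   nonnegative index is still beyond it. *)
have H := @coarse_transfer_rec os 0 0 (\row_i -1) _ _ oall.
rewrite -lez_nat; apply: (@le_trans _ _ ((chain_cost 0 os X)%:Z + (nbad D 0 os)%:Z +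
    \sum_i ((if D i then 1%R else 0%R) + `|(scale k X) 0 i| - `|X 0 i|) + (nrm X)%:Z)).
  rewrite PoszD lerD2r.
  apply: (le_trans (H _ _)) => [i Di|i Di|]; rewrite ?mxE ?addNr ?mulr0 ?Xge0 // lerD2l.
  apply: ler_sum => i _; rewrite /pot !mxE; case: (boolP (D i)) => Di; last first.
    by rewrite X0 // mulr0; mlia.
  have := Xge0 Di; have : 0 <= (k i)%:Z * X 0 i by rewrite mulr_ge0 ?Xge0.
  mlia.
have h2 : \sum_i (if D i then 1%R else 0%R) = #|D|%:Z :> int.
  rewrite -big_mkcond -sum1_card (big_morph Posz PoszD (erefl _)) /=.
  by apply: eq_bigl => i; rewrite unfold_in.
rewrite sumrB big_split /= h2 -!nrmZ !PoszD; move: (#|D|) => a; lia.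
Qed.

End Transfer.

(** * Weighted counting of chains *)

Section Weights.
Context {R : realType} {d : nat}.
Variables (D : pred 'I_d) (q th : R).
Hypotheses (q0 : 0 < q) (q1 : q < 1) (th1 : 1 <= th).

(* Twice the backward part of a gap in [D], its full length outside [D]; a chain
   cheaper than the l1 distance has total excess at most its number of edges. *)
Definition excess1 (i : 'I_d) (g : int) : nat :=
  if D i then absz (`|g| - g)%R else absz g.

Definition excess (g : vertex d) : nat := (\sum_i excess1 i (g 0%R i))%N.

Fixpoint chain_excess (v : vertex d) (os : chain d) : nat :=
  if os is o :: os' then
    (excess (o.1 - v)%R + chain_excess (step_next o.1 o.2) os')%N
  else 0%N.

(** [q] makes forward gaps summable at the price of [q ^+ nrm X] for a whole chain; the powers of
    1/2 do it for backward and sideways moves; [th] marks the directions that make a gap bad. *)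
Definition weight1 (i : 'I_d) (g : int) : R :=
  (if D i then q ^+ absz g else 1) * 2^-1 ^+ excess1 i g *
  (if D i && (g <= 1) then th else 1).

(** Of the factor 4 per edge, one 2 compensates [2^-1 ^+ excess] along a cheap chain and the other
    survives as [2 ^+ size os], which lets the same count bound the number of edges. *)
Definition weight (g : vertex d) : R := 4 * \prod_i weight1 i (g 0 i).

Fixpoint chain_weight (v : vertex d) (os : chain d) : R :=
  if os is o :: os' then weight (o.1 - v) * chain_weight (step_next o.1 o.2) os'
  else 1.

Let th0 : 0 < th. Proof. exact: lt_le_trans ltr01 th1. Qed.

Lemma weight1_ge0 i g : 0 <= weight1 i g.
Proof.
rewrite /weight1 !mulr_ge0 //; try by case: ifP => // _; rewrite ?exprn_ge0 // ltW.
Qed.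

Lemma weight_ge0 g : 0 <= weight g.
Proof. by rewrite mulr_ge0 // prodr_ge0 // => i _; exact: weight1_ge0. Qed.

Lemma chain_weight_ge0 v os : 0 <= chain_weight v os.
Proof. by elim: os v => //= o os IH v; rewrite mulr_ge0 // weight_ge0. Qed.

Lemma geometric_sum_le (a : R) N : 0 <= a < 1 -> \sum_(i < N) a ^+ i <= (1 - a)^-1.
Proof.
move=> /andP[a0 a1]; have h : 0 < 1 - a by rewrite subr_gt0.
rewrite -(ler_pM2l h) mulfV ?gt_eqF //.
by rewrite -(opprB a 1) mulNr -subrX1 opprB gerBl exprn_ge0.
Qed.

Definition weight1_bound (i : 'I_d) : R := if D i then (1 - q)^-1 + 3 * th else 3.

Lemma half_sum_le N : \sum_(n < N) (2^-1 : R) ^+ n <= 2.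
Proof.
apply: le_trans (geometric_sum_le _ _) _; first by apply/andP; split; lra.
by rewrite (_ : 1 - 2^-1 = 2^-1 :> R) ?invrK //; field.
Qed.

(** In a direction of [D], negative gaps give at most [th], the geometric series [(1 - q)^-1], and
    the gaps 0 and 1 another [th] each. Elsewhere the bound is 2 for the nonnegative and 1 for the
    negative gaps. *)
Lemma weight1_sum i N : \sum_(j < N + N.+1) weight1 i (j%:Z - N%:Z) <= weight1_bound i.
Proof.
rewrite big_split_ord /=.
have neg : \sum_(j < N) weight1 i (j%:Z - N%:Z) <= (if D i then th else 1).
  rewrite (reindex_inj rev_ord_inj) /=.
  apply: (@le_trans _ _ (\sum_(j < N) (if D i then th else 1) * (2^-1 * 2^-1 ^+ j))).
    apply: ler_sum => j _; rewrite /weight1 /excess1.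
    have -> : (N - j.+1)%:Z - N%:Z = - j.+1%:Z by have := ltn_ord j; lia.
    case: (D i) => /=; last first.
      by rewrite !mul1r mulr1 -exprS.
    rewrite [leLHS]mulrC; apply: ler_wpM2l; first exact: ltW.
    rewrite -exprS -[leRHS]mul1r; apply: ler_pM.
    - by rewrite exprn_ge0 // ltW.
    - by rewrite exprn_ge0.
    - by rewrite exprn_ile1 // ltW.
    - apply: ler_wiXn2l; [lra | lra | lia].
  rewrite -mulr_sumr -mulr_sumr -[leRHS]mulr1; apply: ler_wpM2l.
    by case: ifP => // _; exact: ltW.
  by have := half_sum_le N; lra.
have pos : \sum_(j < N.+1) weight1 i ((N + j)%:Z - N%:Z) <=
    (if D i then (1 - q)^-1 + 2 * th else 2).
  case: (boolP (D i)) => Di; last first.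
    apply: le_trans (half_sum_le N.+1); apply: ler_sum => j _.
    rewrite /weight1 /excess1 (negPf Di) /= mul1r mulr1.
    by have -> : (N + j)%:Z - N%:Z = j%:Z by lia.
  apply: (@le_trans _ _ (\sum_(j < N.+1) (q ^+ j + (if (j < 2)%N then th else 0)))).
    apply: ler_sum => j _; rewrite /weight1 /excess1 Di andTb.
    have -> : (N + j)%:Z - N%:Z = j%:Z by lia.
    rewrite absz_nat ger0_norm // subrr absz0 expr0 mulr1.
    have -> : (j%:Z <= 1) = (j < 2)%N by lia.
    case: ifP => _; last by rewrite mulr1 addr0.
    rewrite -[leLHS]add0r; apply: lerD; first by rewrite exprn_ge0 // ltW.
    by rewrite ger_pMl // exprn_ile1 // ltW.
  rewrite big_split /=; apply: lerD; first by rewrite geometric_sum_le // ltW.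
  case: (N) => [|n]; first by rewrite big_ord_recl big_ord0 /= addr0 mulr_natl mulr2n lerDl ltW.
  by rewrite !big_ord_recl big1 //= addr0 mulr_natl mulr2n.
apply: le_trans (lerD neg pos) _.
by rewrite /weight1_bound; case: (D i); lra.
Qed.

(** The weight is a product over coordinates and the points are distinct, so they embed into a box
    [[-N, N]^d], over which the sum factorizes. *)
Lemma weight_sum (srcs : seq (vertex d)) (v : vertex d) : uniq srcs ->
  \sum_(u <- srcs) weight (u - v) <= 4 * \prod_i weight1_bound i.
Proof.
move=> us; rewrite /weight -mulr_sumr ler_pM2l //.
pose N := (\sum_(u <- srcs) nrm (u - v))%N.
have small (u : vertex d) i : u \in srcs -> (absz (((u - v) 0 i)%R) <= N)%N.
  move=> uin; rewrite /N (big_rem u uin) /=; apply: leq_trans (leq_addr _ _).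
  by rewrite /nrm (bigD1 i) //= leq_addr.
apply: (@le_trans _ _ (\prod_i \sum_(j < N + N.+1) weight1 i (j%:Z - N%:Z))); last first.
  apply: ler_prod => i _; rewrite weight1_sum andbT.
  by apply: sumr_ge0 => j _; exact: weight1_ge0.
rewrite bigA_distr_bigA /=.
rewrite addnS.
pose h (u : vertex d) : {ffun 'I_d -> 'I_(N + N).+1} :=
  [ffun i => inord (absz ((u - v) 0 i + N%:Z)%R)].
have hE u i : u \in srcs -> (h u i)%:Z - N%:Z = (u - v) 0 i.
  move=> uin; rewrite ffunE inordK; have := small u i uin.
    by move: ((u - v) 0 i) => z; lia.
  by move: ((u - v) 0 i) => z; lia.
pose G (f : {ffun 'I_d -> 'I_(N + N).+1}) : R := \prod_i weight1 i ((f i)%:Z - N%:Z).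
rewrite (eq_big_seq (fun u => G (h u))); last first.
  by move=> u uin; rewrite /G; apply: eq_bigr => i _; rewrite hE.
rewrite -(big_map h xpredT G) big_uniq /=; last first.
  rewrite map_inj_in_uniq // => u u' uin uin' e; apply/rowP => i.
  by have := hE u i uin; rewrite e hE // !mxE => /addIr.
rewrite [leRHS](bigID (mem [seq h i | i <- srcs])) /=.
rewrite -[leLHS]addr0; apply: lerD => //; apply: sumr_ge0 => f _.
by rewrite prodr_ge0 // => i _; exact: weight1_ge0.
Qed.

End Weights.

(** * First moment of the weighted number of open chains *)

Section FirstMoment.
Context {R : realType} {d : nat}.
Variables (D : pred 'I_d) (q th : R).
Hypotheses (q0 : 0 < q) (q1 : q < 1) (th1 : 1 <= th).

Let th0 : 0 < th. Proof. exact: lt_le_trans ltr01 th1. Qed.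

Lemma ler_prod_ge1 (F : 'I_d -> R) i0 : (forall i, 1 <= F i) -> F i0 <= \prod_i F i.
Proof.
move=> F1; rewrite (bigD1 i0) //= ler_peMr //; first exact: le_trans (F1 i0).
elim/big_ind : _ => // x y x1 y1; rewrite -[1]mulr1; exact: ler_pM.
Qed.

Lemma weight_ge (g : vertex d) :
  4 * (q ^+ nrm g * 2^-1 ^+ excess D g * th ^+ bad_gap D g) <= weight D q th g.
Proof.
rewrite /weight ler_pM2l // !big_split /=.
apply: ler_pM.
- by rewrite mulr_ge0 // exprn_ge0 // ltW.
- by rewrite exprn_ge0 // ltW.
- apply: ler_pM; [by rewrite exprn_ge0 // ltW|by rewrite exprn_ge0| |].
    rewrite /nrm -prodrXr; apply: ler_prod => i _; rewrite exprn_ge0 ?(ltW q0) //=.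
    by case: ifP => // _; rewrite exprn_ile1 // ltW.
  by rewrite /excess -prodrXr.
have h i : 1 <= (if D i && (g 0 i <= 1) then th else 1) by case: ifP.
rewrite /bad_gap; case: (boolP [exists i, _]) => [/existsP[i Di]|_] /=.
  by rewrite expr1; apply: le_trans (ler_prod_ge1 i h); rewrite Di.
rewrite expr0; elim/big_ind : _ => // x y x1 y1; rewrite -[1]mulr1; exact: ler_pM.
Qed.

Lemma chain_weight_ge (X v : vertex d) os :
  4 ^+ size os * (q ^+ chain_cost v os X * 2^-1 ^+ chain_excess D v os * th ^+ nbad D v os)
  <= chain_weight D q th v os.
Proof.
elim: os v => [|o os IH] v /=.
  by rewrite !expr0 !mulr1 mul1r exprn_ile1 // ltW.
apply: le_trans (ler_pM _ _ (weight_ge _) (IH _)).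
- rewrite !exprD exprS le_eqVlt; apply/orP; left; apply/eqP.
  move: (4 ^+ size os) (q ^+ nrm _) (q ^+ chain_cost _ _ _) (2^-1 ^+ excess _ _).
  move: (2^-1 ^+ chain_excess _ _ _) (th ^+ bad_gap _ _) (th ^+ nbad _ _ _) => *; ring.
- by rewrite !mulr_ge0 // exprn_ge0 // ltW.
- by rewrite !mulr_ge0 // exprn_ge0 // ltW.
Qed.

(** In a direction of [D] a gap [g] costs [|g|] and advances by [g], and the difference is its
    excess; elsewhere the whole cost is excess. Each open edge advances by at most 1 for free, and
    the advances telescope. *)
Lemma chain_excess_le (X v : vertex d) os :
  (chain_excess D v os)%:Z <= (chain_cost v os X)%:Z
    - \sum_(i | D i) (X 0 i - v 0 i) + (size os)%:Z.
Proof.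
elim: os v => [|[u [j b]] os IH] v /=.
  rewrite addr0 subr_ge0 nrmZ [leRHS](bigID D) /= -[leLHS]addr0; apply: lerD.
    by apply: ler_sum => i _; rewrite !mxE; mlia.
  exact: sumr_ge0.
have := IH (step_next u (j, b)).
suff : (excess D (u - v))%:Z <= (nrm (u - v))%:Z -
   \sum_(i | D i) (step_next u (j, b) 0 i - v 0 i) + 1.
  have -> : \sum_(i | D i) (X 0 i - v 0 i) =
     \sum_(i | D i) (X 0 i - step_next u (j, b) 0 i) +
     \sum_(i | D i) (step_next u (j, b) 0 i - v 0 i).
    by rewrite -big_split /=; apply: eq_bigr => i _; mlia.
  by rewrite !PoszD; lia.
have -> : 1%R = \sum_(i < d) (if i == j then 1%R else 0%R) :> int.
  by rewrite -big_mkcond big_pred1_eq.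
rewrite nrmZ /excess (big_morph Posz PoszD (erefl _)) [\sum_(i | D i) _]big_mkcond /=.
rewrite -sumrN -!big_split /=; apply: ler_sum => i _.
rewrite step_nextE !mxE /excess1.
by case: (D i); case: (i == j); case: b; mlia.
Qed.

Lemma chain_weight_bound (X : vertex d) os (Y : R) :
  (forall i, D i -> 0 <= X 0 i) -> (forall i, ~~ D i -> X 0 i = 0) ->
  (chain_cost 0%R os X <= nrm X)%N ->
  Y <= th ^+ nbad D 0 os * 2 ^+ size os ->
  q ^+ nrm X * Y <= chain_weight D q th 0 os.
Proof.
move=> Xge0 X0 cost hY; apply: le_trans (chain_weight_ge X 0 os).
have : (chain_excess D 0 os)%:Z <= (size os)%:Z.
  apply: le_trans (chain_excess_le X 0 os) _.
  suff -> : \sum_(i | D i) (X 0 i - (0 : vertex d) 0 i) = (nrm X)%:Z.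
    by move: cost; lia.
  rewrite nrmZ [RHS](bigID D) /= [X in _ + X]big1 ?addr0 => [|i nD]; last by rewrite X0.
  by apply: eq_bigr => i Di; rewrite mxE subr0 ger0_norm // Xge0.
rewrite lez_nat => hex.
apply: (@le_trans _ _ (q ^+ nrm X * (th ^+ nbad D 0 os * 2 ^+ size os))).
  by rewrite ler_pM2l // exprn_gt0.
apply: (@le_trans _ _ (4 ^+ size os *
   (q ^+ nrm X * 2^-1 ^+ size os * th ^+ nbad D 0 os))).
  rewrite le_eqVlt; apply/orP; left; apply/eqP; have -> : 4 = 2 * 2 :> R by ring.
  rewrite exprMn exprVn.
  have : 2 ^+ size os != 0 :> R by rewrite expf_neq0.
  by move: (2 ^+ size os) (q ^+ _) (th ^+ _) => a b c a0; field.
rewrite ler_pM2l ?exprn_gt0 // ler_pM2r ?exprn_gt0 //.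
apply: ler_pM; [by rewrite exprn_ge0 // ltW|by rewrite exprn_ge0| |].
  by apply: ler_wiXn2l => //; rewrite ltW.
by apply: ler_wiXn2l => //; lra.
Qed.

Fixpoint all_chains (O : seq (vertex d * step d)) (m : nat) : seq (chain d) :=
  if m is m'.+1 then [seq o :: os | o <- O, os <- all_chains O m'] else [:: [::]].

Lemma mem_all_chains O os : {subset os <= O} -> os \in all_chains O (size os).
Proof.
elim: os => [|o os IH] //= sub; apply: allpairs_f; first by apply: sub; rewrite mem_head.
by apply: IH => x xs; apply: sub; rewrite inE xs orbT.
Qed.

(** A superset of the orientations of edges of [s], namely all steps from all endpoints: in this
    product form the steps contribute a factor [2 * d], and [undup] makes the sources distinct as
    [weight_sum] demands. *)
Definition oriented_edges (s : seq (edge d)) : seq (vertex d * step d) :=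
  [seq (u, st) | u <- undup (flatten [seq [:: e.1; e.1 + unitv e.2] | e <- s]),
                 st <- enum {: step d}].

Lemma mem_oriented_edges s o : chain_edge o \in s -> o \in oriented_edges s.
Proof.
case: o => u [i b] es; apply: allpairs_f; last by rewrite mem_enum.
rewrite mem_undup; apply/flatten_mapP; exists (chain_edge (u, (i, b))) => //.
rewrite /chain_edge /step_edge; case: b {es} => /=; rewrite !inE ?eqxx //.
by rewrite subrK eqxx orbT.
Qed.

Definition step_bound : R := (2 * d)%:R * (4 * \prod_i weight1_bound D q th i).

Lemma oriented_edges_sum s v :
  \sum_(o <- oriented_edges s) weight D q th (o.1 - v) <= step_bound.
Proof.
rewrite /oriented_edges big_allpairs_dep /=.
under eq_bigr => u _ do rewrite big_const_seq count_predT -cardE iter_addr_0 -[_ *+ _]mulr_natl.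
rewrite -mulr_sumr card_prod card_ord card_bool mulnC.
by apply: ler_wpM2l => //; apply: weight_sum => //; exact: undup_uniq.
Qed.

(** The count is subcritical: each further edge multiplies it by at most [p * step_bound], whatever
    the endpoint of the previous one. *)
Lemma all_chains_sum s (p : R) m v : 0 <= p -> p * step_bound <= 2^-1 ->
  \sum_(os <- all_chains (oriented_edges s) m) p ^+ m * chain_weight D q th v os
    <= 2^-1 ^+ m.
Proof.
move=> p0 pB; elim: m v => [|m IH] v /=; first by rewrite big_seq1 !expr0 mulr1.
rewrite big_allpairs_dep /=.
apply: (@le_trans _ _ (\sum_(o <- oriented_edges s) (p * weight D q th (o.1 - v)) * 2^-1 ^+ m)).
  apply: ler_sum => o _.
  rewrite [leLHS](eq_bigr (fun os => (p * weight D q th (o.1 - v)) *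
     (p ^+ m * chain_weight D q th (step_next o.1 o.2) os))); last first.
    by move=> os _; rewrite exprS; ring.
  rewrite -mulr_sumr; apply: ler_wpM2l; last exact: IH.
  by rewrite mulr_ge0 // weight_ge0.
rewrite -mulr_suml -mulr_sumr exprS; apply: ler_wpM2r; first by rewrite exprn_ge0.
apply: le_trans pB; apply: ler_wpM2l => //; exact: oriented_edges_sum.
Qed.

(** Used twice: with [th] equal to 1 it detects cheap chains with many edges, with [th] large cheap
    chains with many bad gaps. *)
Definition heavy_chain (X : vertex d) (Y : R) (c : edge d -> bool) : bool :=
  `[< exists os, [/\ all c (map (@chain_edge d) os), uniq (map (@chain_edge d) os),
      (chain_cost 0%R os X <= nrm X)%N & Y <= th ^+ nbad D 0 os * 2 ^+ size os] >].

(* Markov's inequality for the weighted number of chains of open edges. *)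
Lemma heavy_chain_prob (X : vertex d) (Y p : R) s :
  (forall i, D i -> 0 <= X 0 i) -> (forall i, ~~ D i -> X 0 i = 0) ->
  0 < Y -> 0 <= p <= 1 -> p * step_bound <= 2^-1 -> uniq s ->
  Ex p s (fun c => (heavy_chain X Y c)%:R) (@closed_config _) <=
    2 * (q ^+ nrm X * Y)^-1.
Proof.
move=> Xge0 X0 Y0 p01 pB us; have [p0 p1] := andP p01.
have qY : 0 < q ^+ nrm X * Y by rewrite mulr_gt0 // exprn_gt0.
pose O := oriented_edges s.
pose term (os : chain d) (c : edge d -> bool) : R :=
  (q ^+ nrm X * Y)^-1 * (chain_weight D q th 0 os *
    (uniq (map (@chain_edge d) os) && all c (map (@chain_edge d) os))%:R).
have term_ge0 os c : 0 <= term os c.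
  by rewrite !mulr_ge0 // ?invr_ge0 ?(ltW qY) // chain_weight_ge0.
apply: (@le_trans _ _ (Ex p s (fun c =>
   \sum_(m <- iota 0 (size s).+1) \sum_(os <- all_chains O m) term os c) (@closed_config _))).
  apply: Ex_le_support => // c cs; rewrite /heavy_chain; case: asboolP => /=; last first.
    by move=> _; apply: sumr_ge0 => m _; apply: sumr_ge0.
  move=> [os [oall ouniq ocost oY]].
  have osub : {subset map (@chain_edge d) os <= s}.
    by move=> e /(allP oall) /cs.
  have osm : size os \in iota 0 (size s).+1.
    by rewrite mem_iota /= add0n ltnS -(size_map (@chain_edge d)); exact: uniq_leq_size.
  rewrite (big_rem (size os) osm) /=.
  have oin : os \in all_chains O (size os).
    apply: mem_all_chains => o oos; apply: mem_oriented_edges; apply: osub; exact: map_f.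
  rewrite (big_rem os oin) /= -addrA -[leLHS]addr0; apply: lerD.
    rewrite /term ouniq oall /= mulr1 mulrC ler_pdivlMr // mul1r.
    exact: chain_weight_bound.
  by rewrite addr_ge0 //; do ?apply: sumr_ge0 => ? _.
rewrite Ex_sum; under eq_bigr do rewrite Ex_sum.
apply: (@le_trans _ _ (\sum_(m <- iota 0 (size s).+1) (q ^+ nrm X * Y)^-1 * 2^-1 ^+ m)).
  apply: ler_sum => m _.
  apply: le_trans (ler_wpM2l _ (all_chains_sum s m 0 p0 pB)); last by rewrite invr_ge0 ltW.
  rewrite mulr_sumr big_seq_cond [leRHS]big_seq_cond; apply: ler_sum => os; rewrite andbT => oin.
  rewrite /term ExZ ler_pM2l ?invr_gt0 // ExZ mulrC; apply: ler_wpM2r.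
    exact: chain_weight_ge0.
  have -> : m = size (map (@chain_edge d) os).
    rewrite size_map; elim: m os oin => [|m IH] os; first by rewrite inE => /eqP ->.
    by move=> /allpairsP[[ o os'] /= [_ h ->]] /=; rewrite -IH.
  case: (boolP (uniq _)) => uo /=; first exact: Ex_open_le.
  by rewrite Ex_cst exprn_ge0.
rewrite -mulr_sumr mulrC; apply: ler_wpM2r; first by rewrite invr_ge0 ltW.
rewrite -[iota _ _]/(index_iota 0 (size s).+1) big_mkord; exact: half_sum_le.
Qed.

End FirstMoment.

(** * Gain over the l1 norm *)

Definition gain (R : realType) d (p : R) (x : vertex d) : R :=
  (nrm x)%:R - mean_time p x.

Section Gain.
Context {R : realType} {d : nat}.
Implicit Types (p : R) (x y X : vertex d).

Lemma gain_ge0 p x : 0 <= p <= 1 -> 0 <= gain p x.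
Proof. by move=> p01; rewrite subr_ge0 mean_time_nrm. Qed.

Lemma gain_le_nrm p x : 0 <= p <= 1 -> gain p x <= (nrm x)%:R.
Proof. by move=> p01; rewrite gerBl mean_time_ge0. Qed.

Lemma gain_le_prob p p' x : 0 <= p -> p <= p' -> p' <= 1 -> gain p x <= gain p' x.
Proof. by move=> *; rewrite lerD2l lerN2 mean_time_antitone. Qed.

Lemma gainD p x y : 0 <= p <= 1 -> (forall i, 0 <= x 0 i) -> (forall i, 0 <= y 0 i) ->
  gain p x + gain p y <= gain p (x + y).
Proof.
move=> p01 x0 y0; rewrite /gain.
have -> : nrm (x + y) = (nrm x + nrm y)%N.
  rewrite /nrm -big_split /=; apply: eq_bigr => i _; rewrite mxE.
  by have := x0 i; have := y0 i; mlia.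
by have := mean_timeD x y p01; rewrite natrD; lra.
Qed.

Lemma gain_le p x y : 0 <= p <= 1 -> (forall i, 0 <= x 0 i) ->
  (forall i, x 0 i <= y 0 i) -> gain p x <= gain p y.
Proof.
move=> p01 x0 xy; rewrite -(subrK x y) addrC; apply: le_trans (gainD p01 x0 _).
  by rewrite lerDl gain_ge0.
by move=> i; rewrite !mxE subr_ge0.
Qed.

Lemma chain_cost_size x os y : (nrm (y - x) <= chain_cost x os y + size os)%N.
Proof.
elim: os x => [|o os IH] x /=; first by rewrite addn0.
apply: leq_trans (nrm_tri y x o.1) _; rewrite addnC -addnA leq_add2l addnS.
apply: leq_trans (nrm_tri y o.1 (step_next o.1 o.2)) _.
by rewrite nrm_step addn1 ltnS; exact: IH.
Qed.

(** Unless a heavy chain exists, the optimal coarse chain has at most [b] bad gaps and its lift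
    loses at most [b + #|D|]. On the remaining event the trivial bound on the fine passage time
    loses at most [nrm X]. *)
Lemma gain_coarse (D : pred 'I_d) (k : 'I_d -> nat) (q th p p' : R) X (b : nat) :
  (forall i, ~~ D i -> k i = 1%N) ->
  (forall i, ~~ D i -> X 0 i = 0) -> (forall i, D i -> 0 <= X 0 i) ->
  0 < q -> q < 1 -> 1 <= th -> 0 <= p' <= 1 -> p = 1 - (1 - p') ^+ (\prod_i k i)%N ->
  p * step_bound D q th <= 2^-1 ->
  gain p X <= gain p' (scale k X) + b%:R + #|D|%:R +
    (nrm X)%:R * (2 * (q ^+ nrm X * th ^+ b)^-1).
Proof.
move=> k1 X0 Xge0 q0 q1 th1 p'01 pE pB.
have p01 : 0 <= p <= 1.
  have [h0 h1] := andP p'01.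
  by rewrite pE subr_ge0 gerBl exprn_ge0 ?exprn_ile1 ?subr_ge0 ?gerBl.
rewrite /gain -lerBlDr.
set Pi := 2 * _.
suff : (mean_time p' (scale k X)) - ((nrm (scale k X))%:R - (nrm X)%:R + b%:R + #|D|%:R
   + (nrm X)%:R * Pi) <= mean_time p X by lra.
apply: mean_time_ge => s us.
apply: (@le_trans _ _ (Ex p' (flatten (map (cell k) s))
   (fun c => (passage_time c 0 (scale k X))%:R) (@closed_config _) -
   ((nrm (scale k X))%:R - (nrm X)%:R + b%:R + #|D|%:R + (nrm X)%:R * Pi))).
  by rewrite lerD2r mean_time_le // cells_uniq.
rewrite lerBlDr.
pose Psi (c : edge d -> bool) : R := (passage_time c 0 X)%:R +
  (((nrm (scale k X))%:R - (nrm X)%:R + b%:R + #|D|%:R) +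
   (nrm X)%:R * (heavy_chain D th X (th ^+ b) c)%:R).
apply: (@le_trans _ _ (Ex p' (flatten (map (cell k) s))
   (fun c => Psi (fun e => has c (cell k e))) (@closed_config _))).
  apply: Ex_le => // c; rewrite /Psi; set co := fun e => has c (cell k e).
  case: (boolP (heavy_chain _ _ _ _ _)) => hc.
    rewrite mulr1.
    have h1 : (passage_time c 0 (scale k X))%:R <= (nrm (scale k X))%:R :> R.
      by rewrite ler_nat -{2}[scale k X]subr0; exact: passage_time_nrm.
    have h2 : 0 <= (passage_time co 0 X)%:R :> R by [].
    have h3 : 0 <= b%:R :> R by [].
    have h4 : 0 <= #|D|%:R :> R by [].
    lra.
  have [ os [oall ouniq ocost]] := passage_time_chain co 0 X.
  have nb : (nbad D 0%R os <= b)%N.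
    rewrite leqNgt; apply: contra hc => hb; apply/asboolP; exists os; split => //.
      by apply: leq_trans ocost _; rewrite -{2}[X]subr0; exact: passage_time_nrm.
    rewrite -[leLHS]mulr1; apply: ler_pM => //.
    - by rewrite exprn_ge0 // (le_trans ler01).
    - by apply: ler_weXn2l => //; exact: ltnW.
    - by rewrite exprn_ege1 // ler1n.
  have := coarse_transfer k1 X0 Xge0 oall.
  rewrite -(ler_nat R) !natrD mulr0 => h1.
  move: ocost nb; rewrite -!(ler_nat R) => h2 h3.
  lra.
rewrite (Ex_coarse p' s Psi _ (size_cell k) (@cell_disjoint _ k)) -pE.
have -> : (fun e => has (@closed_config _) (cell k e)) = @closed_config (edge d).
  by apply/funext => e; apply/hasPn.
rewrite ExD lerD2l ExD Ex_cst lerD2l ExZ; apply: ler_wpM2l => //.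
apply: heavy_chain_prob => //.
by rewrite exprn_gt0 // (lt_le_trans ltr01).
Qed.

(** Each open edge saves at most one step, so the gain is at most the number of edges of an optimal
    chain, and that number exceeds [m] only if a heavy chain exists. *)
Lemma gain_upper (D : pred 'I_d) (q p : R) X (m : nat) :
  (forall i, ~~ D i -> X 0 i = 0) -> (forall i, D i -> 0 <= X 0 i) ->
  0 < q -> q < 1 -> 0 <= p <= 1 -> p * step_bound D q 1 <= 2^-1 ->
  gain p X <= m%:R + (nrm X)%:R * (2 * (q ^+ nrm X * 2 ^+ m)^-1).
Proof.
move=> X0 Xge0 q0 q1 p01 pB; rewrite /gain lerBlDr -lerBlDl.
set Pi := 2 * _; apply: mean_time_ge => s us.
rewrite lerBlDl.
apply: (@le_trans _ _ (m%:R + (nrm X)%:R * Ex p s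
   (fun c => (heavy_chain D 1 X (2 ^+ m) c)%:R) (@closed_config _) +
   Ex p s (fun c => (passage_time c 0 X)%:R) (@closed_config _))); last first.
  rewrite lerD2r lerD2l; apply: ler_wpM2l => //; apply: heavy_chain_prob => //.
rewrite -ExZ -[X in X + _ + _](Ex_cst p s _ (@closed_config _)) -!ExD.
rewrite -[leLHS](Ex_cst p s _ (@closed_config _)).
apply: Ex_le => // c.
case: (boolP (heavy_chain _ _ _ _ _)) => hc.
  by rewrite mulr1 -!natrD ler_nat; lia.
have [ os [oall ouniq ocost]] := passage_time_chain c 0 X.
have nb : (size os <= m)%N.
  rewrite leqNgt; apply: contra hc => hb; apply/asboolP; exists os; split => //.
    by apply: leq_trans ocost _; rewrite -{2}[X]subr0; exact: passage_time_nrm.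
  rewrite expr1n mul1r; apply: ler_weXn2l; [by rewrite ler1n | exact: ltnW].
rewrite mulr0 addr0 -natrD ler_nat; have := chain_cost_size 0 os X.
by rewrite subr0; lia.
Qed.

End Gain.

(** * Gain per unit length *)

Definition gain_at (R : realType) d (p : R) (z : 'rV[R]_d) (n : nat) : R :=
  gain p (floorv (n%:R *: z)).

(** By superadditivity the supremum is also the limit; taken as a supremum it bounds the gain at
    every [n] without error term. *)
Definition rate (R : realType) d (p : R) (z : 'rV[R]_d) : R :=
  sup [set gain_at p z n.+1 / n.+1%:R | n in [set: nat]].

Section Rate.
Context {R : realType} {d : nat}.
Variables (p : R) (z : 'rV[R]_d).
Hypotheses (p01 : 0 <= p <= 1) (z0 : forall i, 0 <= z 0 i).

Lemma floorv_ge0 n i : 0 <= floorv (n%:R *: z) 0 i.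
Proof. by rewrite !mxE floor_ge0 mulr_ge0. Qed.

Lemma nrm_floorv n : (nrm (floorv (n%:R *: z)))%:R <= n%:R * norm1 z.
Proof.
rewrite /nrm natr_sum /norm1 mulr_sumr; apply: ler_sum => i _.
have h := floorv_ge0 n i.
rewrite natr_absz (ger0_norm h) !mxE ger0_norm //; exact: floor_le.
Qed.

Lemma gain_at_ge0 n : 0 <= gain_at p z n.
Proof. exact: gain_ge0. Qed.

Lemma gain_at_le n : gain_at p z n <= n%:R * norm1 z.
Proof. exact: le_trans (gain_le_nrm _ p01) (nrm_floorv n). Qed.

(** The sum of two integer parts is at most the integer part of the sum, and the gain is
    superadditive and monotone on nonnegative vectors. *)
Lemma gain_atD n m : gain_at p z n + gain_at p z m <= gain_at p z (n + m).
Proof.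
apply: le_trans (gainD p01 (floorv_ge0 n) (floorv_ge0 m)) _.
apply: gain_le => // i; first by rewrite mxE addr_ge0 ?floorv_ge0.
rewrite !mxE floor_ge_int natrD mulrDl intrD.
by apply: lerD; exact: floor_le.
Qed.

Lemma gain_atM n j : j%:R * gain_at p z n <= gain_at p z (j * n).
Proof.
elim: j => [|j IH]; first by rewrite mul0r gain_at_ge0.
rewrite mulSn -natr1 mulrDl mul1r addrC.
by apply: le_trans (gain_atD _ _); rewrite lerD2l.
Qed.

Lemma rate_has_sup : has_sup [set gain_at p z n.+1 / n.+1%:R | n in [set: nat]].
Proof.
split; first by exists (gain_at p z 1 / 1), 0%N.
exists (norm1 z) => _ [n _ <-]; rewrite ler_pdivrMr // mulrC; exact: gain_at_le.
Qed.

Lemma rate_ge n : gain_at p z n <= n%:R * rate p z.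
Proof.
case: n => [|n]; first by rewrite mul0r (le_trans (gain_at_le 0)) // mul0r.
rewrite mulrC -ler_pdivrMr //; apply: ub_le_sup; last by exists n.
by case: rate_has_sup.
Qed.

Lemma rate_ge0 : 0 <= rate p z.
Proof. by have := rate_ge 1; rewrite mul1r; apply: le_trans; exact: gain_at_ge0. Qed.

(** The constant [K] is harmless: a violation at [n] is multiplied by at least [j] at [j * n], and
    eventually exceeds [K]. *)
Lemma rate_le (M K : R) : (forall n, gain_at p z n <= n%:R * M + K) -> rate p z <= M.
Proof.
move=> h; apply: ge_sup; first by case: rate_has_sup.
move=> _ [n _ <-]; rewrite ler_pdivrMr //; set x := gain_at _ _ _.
rewrite leNgt; apply/negP => hx.
pose j := (Num.truncn (K / (x - M * n.+1%:R))).+1.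
have hj : K / (x - M * n.+1%:R) < j%:R by exact: truncnS_gt.
have := h (j * n.+1)%N; have := gain_atM n.+1 j; rewrite -/x.
move: hj; rewrite ltr_pdivrMr ?subr_gt0 // natrM.
move: (gain_at _ _ _) (n.+1%:R) (j%:R) => *; lra.
Qed.

(** Fekete's argument: Euclidean division of the index by one with a nearly optimal ratio. *)
Lemma rate_cvg : (fun n => gain_at p z n.+1 / n.+1%:R) @ \oo --> rate p z.
Proof.
apply/cvgrPdist_le => e e0.
have [_ [m _ <-] hm] := sup_adherent (divr_gt0 e0 (ltr0n R 2)) rate_has_sup.
set b := gain_at p z m.+1 in hm *.
near=> n.
have h1 := rate_ge n.+1.
have n0 : 0 < n.+1%:R :> R by [].
rewrite ger0_norm; last by rewrite subr_ge0 ler_pdivrMr // mulrC.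
have hb : b <= e / 2 * n.+1%:R.
  have : b / (e / 2) <= n.+1%:R.
    apply: le_trans (_ : n%:R <= _); last by rewrite ler_nat.
    near: n; exact: nbhs_infty_ger.
  by rewrite ler_pdivrMr ?divr_gt0 // mulrC.
have h2 : ((n.+1 %/ m.+1)%N)%:R * b <= gain_at p z n.+1.
  apply: le_trans (gain_atM _ _) _.
  rewrite {2}(divn_eq n.+1 m.+1); apply: le_trans (gain_atD _ _).
  by rewrite lerDl gain_at_ge0.
have h3 : n.+1%:R <= ((n.+1 %/ m.+1)%N)%:R * m.+1%:R + m.+1%:R :> R.
  rewrite -natrM -natrD ler_nat {1}(divn_eq n.+1 m.+1) leq_add2l ltnW //.
  exact: ltn_pmod.
have b0 : 0 <= b by exact: gain_at_ge0.
have h4 : n.+1%:R * (b / m.+1%:R) <= gain_at p z n.+1 + b.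
  have c0 : 0 <= b / m.+1%:R by rewrite divr_ge0.
  apply: le_trans (ler_wpM2r c0 h3) _; rewrite mulrDl -mulrA !(mulrC m.+1%:R).
  by rewrite divfK // lerD2r.
rewrite lerBlDr -lerBlDl ler_pdivlMr //.
move: hm h1 hb h4; rewrite -/(rate p z); move: (b / _) (n.+1%:R) n0 (gain_at p z n.+1) (rate p z).
move=> c N N0 g r hm h1 hb h4; nra.
Unshelve. all: end_near. Qed.

End Rate.

(** * Upper bound for the rate and comparison of two lattices *)

Section RateCompare.
Context {R : realType} {d : nat}.

Lemma rate_le_prob (p p' : R) (z : 'rV[R]_d) : 0 <= p -> p <= p' -> p' <= 1 ->
  (forall i, 0 <= z 0 i) -> rate p z <= rate p' z.
Proof.
move=> p0 pp' p'1 z0; apply: (@rate_le _ _ _ _ _ _ _ 0) => // [|n].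
  by rewrite p0 (le_trans pp').
rewrite addr0; apply: le_trans (rate_ge _ z0 n); last by rewrite (le_trans p0 pp').
exact: gain_le_prob.
Qed.

(** For [q = expR (- kappa)] the geometric series is at most [2 / kappa], and the condition on [th]
    lets bad gaps add at most [kappa^-1]: a factor [3 / kappa] per direction of [D]. *)
Lemma step_bound_le (D : pred 'I_d) (kappa th : R) : 0 < kappa <= 1 -> 1 <= th ->
  3 * th <= kappa^-1 ->
  step_bound D (expR (- kappa)) th <= (8 * d * 3 ^ d)%:R * kappa ^- #|D|.
Proof.
move=> /andP[k0 k1] th1 hth; rewrite /step_bound.
have h1 : (1 - expR (- kappa))^-1 <= 2 / kappa.
  rewrite -[leRHS]invrK lef_pV2 ?posrE ?invr_gt0 ?divr_gt0 //; last first.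
    by rewrite subr_gt0 expR_lt1 oppr_lt0.
  rewrite invf_div expRN.
  suff : (expR kappa)^-1 <= 1 - kappa / 2 by lra.
  rewrite -[leLHS]mul1r ler_pdivrMr ?expR_gt0 //.
  have := expR_ge1Dx kappa; move: (expR kappa) => E hE; nra.
have -> : (8 * d * 3 ^ d)%:R * kappa ^- #|D| = (2 * d)%:R * (4 *
    \prod_(i < d) (3 * (if D i then kappa^-1 else 1))) :> R.
  rewrite big_split /= prodr_const card_ord -big_mkcond /= prodr_const exprVn.
  rewrite !natrM natrX; ring.
apply: ler_wpM2l => //; rewrite ler_pM2l //; apply: ler_prod => i _.
rewrite /weight1_bound; apply/andP; split.
  case: ifP => // _; apply: addr_ge0; last by rewrite mulr_ge0 // (le_trans ler01).
  by rewrite invr_ge0 subr_ge0 ltW // expR_lt1 oppr_lt0.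
case: ifP => _; last by rewrite mulr1.
by move: h1 hth; move: (1 - _)^-1 => A; lra.
Qed.

End RateCompare.

Section Compare.
Context {R : realType} {d : nat}.
Variables (D : pred 'I_d) (z : 'rV[R]_d).
Hypotheses (D0 : (0 < #|D|)%N) (z_gt0 : forall i, D i -> 0 < z 0 i).
Hypothesis z_eq0 : forall i, ~~ D i -> z 0 i = 0.

Let z0 i : 0 <= z 0 i.
Proof. by case: (boolP (D i)) => [/z_gt0/ltW//|/z_eq0 ->]. Qed.

(* With [q = expR (- (crowding * r))] the one-step sum of weights times [p <= r ^+ #|D|]
   is at most [1/2]. *)
Definition crowding : R := (16 * d * 3 ^ d)%:R.

Lemma crowding_ge1 : 1 <= crowding.
Proof.
have d0 : (0 < d)%N by apply: leq_trans D0 _; rewrite -[leqRHS]card_ord max_card.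
by rewrite /crowding (ler_nat R 1) !muln_gt0 d0 expn_gt0.
Qed.

Lemma step_bound_small (r p th : R) : 0 < r -> 1 <= th -> 3 * th * (crowding * r) <= 1 ->
  0 <= p -> p <= r ^+ #|D| -> p * step_bound D (expR (- (crowding * r))) th <= 2^-1.
Proof.
move=> r0 th1 hth p0 pr; have K1 := crowding_ge1.
have Kr : 0 < crowding * r by rewrite mulr_gt0 // (lt_le_trans ltr01).
have h3 : 3 * th <= (crowding * r)^-1 by rewrite -[leRHS]mul1r ler_pdivlMr.
have Kr1 : crowding * r <= 1 by nra.
apply: le_trans (ler_wpM2l p0 (step_bound_le D _ th1 h3)) _; first by rewrite Kr.
rewrite mulrA ler_pdivrMr ?exprn_gt0 // exprMn.
have -> : (8 * d * 3 ^ d)%:R = crowding / 2 :> R.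
  by rewrite /crowding (_ : 16 = 2 * 8)%N // !natrM; field.
have KK : crowding <= crowding ^+ #|D|.
  by rewrite -[leLHS]expr1; apply: ler_weXn2l.
have rD : 0 < r ^+ #|D| by rewrite exprn_gt0.
move: KK pr rD; move: (crowding ^+ _) (r ^+ _) => A B KK pr rD.
have : p * crowding <= B * A by apply: ler_pM => //; exact: le_trans K1.
lra.
Qed.

(** The heavy event contributes a length of order [n] times a probability that decays like
    [expR (- (r * n))]. The product is bounded uniformly in [n], so [rate_le] absorbs it. *)
Lemma tail_bound (r S E N : R) (n : nat) : 0 < r -> 0 <= S -> expR (r * n%:R) <= E ->
  0 <= N -> N <= n%:R * S -> N * (2 * E^-1) <= 2 * S / r.
Proof.
move=> r0 S0 hE N0 hN; have h := expR_ge1Dx (r * n%:R).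
have E0 : 0 < E by exact: lt_le_trans (expR_gt0 _) hE.
rewrite mulrA ler_pdivrMr // [leRHS]mulrAC ler_pdivlMr //.
apply: (@le_trans _ _ (2 * S * (r * n%:R))); last first.
  by apply: ler_wpM2l; [rewrite mulr_ge0|lra].
have : N * (2 * r) <= n%:R * S * (2 * r) by apply: ler_wpM2r => //; lra.
lra.
Qed.

Lemma rate_bounded : exists M r0 : R, [/\ 0 < M, 0 < r0 &
  forall r p, 0 < r < r0 -> 0 <= p <= 1 -> p <= r ^+ #|D| -> rate p z <= M * r].
Proof.
have K1 := crowding_ge1; have S0 : 0 <= norm1 z by apply: sumr_ge0.
have l2 : 0 < ln (2 : R) by rewrite ln_gt0 // ltr1n.
set K := crowding in K1 *; set S := norm1 z in S0 *.
(* With [m] about [M * r * n], the factor [2 ^+ m] is at least [expR ((K * S + 1) * (r * n))]: the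
   part [K * S] outweighs [q ^+ nrm X], the extra 1 leaves the decay required by [tail_bound]. *)
pose M := (K * S + 1) / ln 2.
have M0 : 0 < M by rewrite divr_gt0 // ltr_pwDr // mulr_ge0 // (le_trans ler01).
exists M, (3 * K)^-1; split => //.
- by rewrite invr_gt0 mulr_gt0 // (lt_le_trans ltr01).
move=> r p /andP[r0 rK] p01 pr.
have Kpos : 0 < K by exact: lt_le_trans ltr01 K1.
have hr : 3 * 1 * (K * r) <= 1.
  move: rK; rewrite -[X in _ < X]mul1r ltr_pdivlMr ?mulr_gt0 // => /ltW; lra.
have pB := @step_bound_small r p 1 r0 (lexx 1) hr (proj1 (andP p01)) pr.
have q0 := expR_gt0 (- (K * r)).
have q1 : expR (- (K * r)) < 1 by rewrite expR_lt1 oppr_lt0 mulr_gt0.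
apply: (@rate_le _ _ _ _ p01 z0 _ (1 + 2 * S / r)) => n.
pose m := (Num.truncn (M * r * n%:R)).+1.
have m1 : M * r * n%:R <= m%:R by rewrite ltW // truncnS_gt.
have m2 : m%:R <= M * r * n%:R + 1.
  rewrite /m -natr1 lerD2r truncn_le; apply: mulr_ge0 => //.
  by apply: mulr_ge0; exact: ltW.
have X0 i : ~~ D i -> floorv (n%:R *: z) 0 i = 0.
  by move=> Di; rewrite !mxE z_eq0 // mulr0 floor0.
have Xg i : D i -> 0 <= floorv (n%:R *: z) 0 i by move=> _; exact: floorv_ge0.
apply: le_trans (gain_upper m X0 Xg q0 q1 p01 pB) _.
set X := floorv _; set Pi := _ * _^-1.
have hN : (nrm X)%:R <= n%:R * S by exact: nrm_floorv.
suff : (nrm X)%:R * Pi <= 2 * S / r.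
  by move: m2; move: (m%:R) (_ * Pi) (2 * S / r) (n%:R) => *; lra.
apply: (@tail_bound r S _ _ n) => //.
rewrite -(lnK (x := 2)) ?posrE // -!expRM_natl -expRD ler_expR.
have hM : M * ln 2 = K * S + 1 by rewrite /M divfK // gt_eqF.
have : M * r * n%:R * ln 2 <= m%:R * ln 2 by rewrite ler_pM2r.
have -> : M * r * n%:R * ln 2 = (K * S + 1) * (r * n%:R) by rewrite -hM; ring.
have : K * r * (nrm X)%:R <= K * r * (n%:R * S) by rewrite ler_pM2l ?mulr_gt0.
lra.
Qed.

(** [tau] is the change of length: the scaled image of the integer part of [n z] lies below
    [n * tau * z'], and the gain is monotone. The error [delta * r] is the number of bad gaps
    allowed per unit length. *)
Lemma rate_compare (delta : R) : 0 < delta -> exists2 r0 : R, 0 < r0 &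
  forall (r p p' tau : R) (k : 'I_d -> nat) (z' : 'rV[R]_d),
    0 < r < r0 -> 0 <= p' <= 1 -> p = 1 - (1 - p') ^+ (\prod_i k i)%N ->
    p <= r ^+ #|D| -> (forall i, ~~ D i -> k i = 1%N) ->
    (forall i, 0 <= z' 0 i) -> 0 <= tau ->
    (forall i, (k i)%:R * z 0 i <= tau * z' 0 i) ->
    rate p z <= tau * rate p' z' + delta * r.
Proof.
move=> delta0.
have K1 := crowding_ge1; have S0 : 0 <= norm1 z by apply: sumr_ge0.
set K := crowding in K1 *; set S := norm1 z in S0 *.
have Kpos : 0 < K by exact: lt_le_trans ltr01 K1.
(* The balance of [rate_bounded], with [th] instead of 2 and [b] about [delta * r * n]: a small
   [delta] needs a large [th], hence a small [r0]. *)
pose Th := (K * S + 1) / delta; pose th := expR Th.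
have Th0 : 0 < Th by rewrite divr_gt0 // ltr_pwDr // mulr_ge0 // ltW.
have th1 : 1 <= th by rewrite -expR0 ler_expR ltW.
have th0 : 0 < th by exact: expR_gt0.
exists (3 * th * K)^-1; first by rewrite invr_gt0 !mulr_gt0.
move=> r p p' tau k z' /andP[r0 rK] p'01 pE pr k1 z'0 tau0 kz.
have p01 : 0 <= p <= 1.
  have [h0 h1] := andP p'01.
  by rewrite pE subr_ge0 gerBl exprn_ge0 ?exprn_ile1 ?subr_ge0 ?gerBl.
have hr : 3 * th * (K * r) <= 1.
  move: rK; rewrite -[X in _ < X]mul1r ltr_pdivlMr ?mulr_gt0 // => /ltW.
  by rewrite mulrA (mulrC r).
have pB := @step_bound_small r p th r0 th1 hr (proj1 (andP p01)) pr.
have q0 := expR_gt0 (- (K * r)).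
have q1 : expR (- (K * r)) < 1 by rewrite expR_lt1 oppr_lt0 mulr_gt0.
have rho0 : 0 <= rate p' z' by exact: rate_ge0.
apply: (@rate_le _ _ _ _ p01 z0 _ (rate p' z' + 1 + #|D|%:R + 2 * S / r)) => n.
pose b := (Num.truncn (delta * r * n%:R)).+1.
have m1 : delta * r * n%:R <= b%:R by rewrite ltW // truncnS_gt.
have m2 : b%:R <= delta * r * n%:R + 1.
  by rewrite /b -natr1 lerD2r truncn_le !mulr_ge0 // ?(ltW delta0) ?(ltW r0).
have X0 i : ~~ D i -> floorv (n%:R *: z) 0 i = 0.
  by move=> Di; rewrite !mxE z_eq0 // mulr0 floor0.
have Xg i : D i -> 0 <= floorv (n%:R *: z) 0 i by move=> _; exact: floorv_ge0.
apply: le_trans (gain_coarse b k1 X0 Xg q0 q1 th1 p'01 pE pB) _.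
set X := floorv _; set Pi := _ * _^-1.
have hN : (nrm X)%:R <= n%:R * S by exact: nrm_floorv.
have h1 : (nrm X)%:R * Pi <= 2 * S / r.
  apply: (@tail_bound r S _ _ n) => //.
  rewrite -!expRM_natl -expRD ler_expR.
  have hM : delta * Th = K * S + 1 by rewrite /Th mulrC divfK // gt_eqF.
  have : delta * r * n%:R * Th <= b%:R * Th by rewrite ler_pM2r.
  have -> : delta * r * n%:R * Th = (K * S + 1) * (r * n%:R) by rewrite -hM; ring.
  have : K * r * (nrm X)%:R <= K * r * (n%:R * S) by rewrite ler_pM2l ?mulr_gt0.
  lra.
have h2 : gain p' (scale k X) <= (n%:R * tau + 1) * rate p' z'.
  pose N := (Num.truncn (n%:R * tau)).+1.
  have N1 : n%:R * tau <= N%:R by rewrite ltW // truncnS_gt.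
  have N2 : N%:R <= n%:R * tau + 1 by rewrite /N -natr1 lerD2r truncn_le mulr_ge0.
  apply: le_trans (ler_wpM2r rho0 N2).
  apply: le_trans (rate_ge p'01 z'0 N).
  apply: gain_le => // i; first by rewrite mxE mulr_ge0 // floorv_ge0.
  rewrite !mxE floor_ge_int intrM.
  apply: (@le_trans _ _ ((k i)%:R * (n%:R * z 0 i))).
    by apply: ler_wpM2l => //; exact: floor_le.
  apply: (@le_trans _ _ (n%:R * tau * z' 0 i)); last by apply: ler_wpM2r.
  by rewrite mulrCA -mulrA; apply: ler_wpM2l.
by move: h1 h2 m2; move: (_ * Pi) (2 * S / r) (gain _ _) (b%:R) => *; lra.
Qed.

End Compare.

(** * Normalized rate *)

Section Roots.
Context {R : realType} (a : nat).
Hypothesis a0 : (0 < a)%N.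

Lemma powR_invnX (e : R) : 0 <= e -> (e `^ a%:R^-1) ^+ a = e.
Proof.
move=> e0; rewrite -powR_mulrn ?powR_ge0 // -powRrM mulVf ?powRr1 //.
by rewrite pnatr_eq0 -lt0n.
Qed.

Lemma powR_invn_lt (e x : R) : 0 <= e -> 0 <= x -> e < x ^+ a -> e `^ a%:R^-1 < x.
Proof.
move=> e0 x0; rewrite -{1}(powR_invnX e0) ltr_pXn2r // nnegrE //; exact: powR_ge0.
Qed.

Lemma powR_invn_le (e x : R) : 0 <= e -> 0 <= x -> e <= x ^+ a -> e `^ a%:R^-1 <= x.
Proof.
move=> e0 x0; rewrite -{1}(powR_invnX e0) ler_pXn2r // nnegrE //; exact: powR_ge0.
Qed.

End Roots.

Section Bernoulli.
Context {R : realType}.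

Lemma one_sub_exp_le (x : R) K : 0 <= x <= 1 -> 1 - (1 - x) ^+ K <= K%:R * x.
Proof.
move=> /andP[x0 x1]; elim: K => [|K IH]; first by rewrite expr0 subrr mul0r.
have h : (1 - x) ^+ K <= 1 by rewrite exprn_ile1 // ?subr_ge0 // gerBl.
rewrite exprS -natr1; move: IH h; move: (_ ^+ K) => y *; nra.
Qed.

(** From [(1 - x) ^+ K * (1 + K * x) <= 1]. The form [L / (1 + L)] can be inverted exactly: it
    equals [e] for [L = e / (1 - e)]. *)
Lemma one_sub_exp_ge (x L : R) K : 0 <= x <= 1 -> 0 <= L -> L <= K%:R * x ->
  L / (1 + L) <= 1 - (1 - x) ^+ K.
Proof.
move=> /andP[x0 x1] L0 LK.
have h : (1 - x) ^+ K * (1 + K%:R * x) <= 1.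
  elim: K {LK} => [|K IH]; first by rewrite expr0 mul0r addr0 mulr1.
  apply: le_trans IH; rewrite exprSr -mulrA; apply: ler_wpM2l.
    by rewrite exprn_ge0 // subr_ge0.
  rewrite -natr1; have : 0 <= K%:R :> R by []; move: (K%:R) => y *; nra.
have y0 : 0 <= (1 - x) ^+ K by rewrite exprn_ge0 // subr_ge0.
rewrite ler_pdivrMr; last lra.
move: h y0 LK; move: (_ ^+ K) (K%:R * x) => y u *; nra.
Qed.

End Bernoulli.

(** * Almost monotonicity of the normalized rate *)

Section NormalizedRate.
Context {R : realType} {d : nat}.
Variable D : pred 'I_d.
Hypothesis D0 : (0 < #|D|)%N.

Definition positive_on (z : 'rV[R]_d) :=
  (forall i, D i -> 0 < z 0 i) /\ (forall i, ~~ D i -> z 0 i = 0).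

Definition geomean (z : 'rV[R]_d) : R := \prod_(i | D i) (z 0 i `^ #|D|%:R^-1).

Definition normalized_rate (z : 'rV[R]_d) (e : R) : R :=
  rate e z / (geomean z * e `^ #|D|%:R^-1).

Lemma positive_on_ge0 z : positive_on z -> forall i, 0 <= z 0 i.
Proof. by move=> [h1 h2] i; case: (boolP (D i)) => [/h1/ltW//|/h2 ->]. Qed.

Lemma geomean_gt0 z : positive_on z -> 0 < geomean z.
Proof. by move=> [h _]; apply: prodr_gt0 => i /h zi; exact: powR_gt0. Qed.

Lemma geomeanX z : positive_on z -> geomean z ^+ #|D| = \prod_(i | D i) z 0 i.
Proof.
move=> [h _]; rewrite -prodrXl; apply: eq_bigr => i /h /ltW zi.
exact: powR_invnX.
Qed.

Lemma normalized_rate_bounded z : positive_on z -> exists B e0 : R,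
  [/\ 0 < B, 0 < e0 & forall e, 0 < e < e0 -> normalized_rate z e <= B].
Proof.
move=> hz; have [h1 h2] := hz; have g0 := geomean_gt0 hz.
have [M [r0 [M0 r00 hM]]] := rate_bounded D0 h1 h2.
exists (M / geomean z), (Num.min 1 (r0 ^+ #|D|)); split.
- exact: divr_gt0.
- by rewrite lt_min ltr01 exprn_gt0.
move=> e /andP[e0]; rewrite lt_min => /andP[e1 er].
have rt0 : 0 < e `^ #|D|%:R^-1 by exact: powR_gt0.
rewrite /normalized_rate ler_pdivrMr ?mulr_gt0 // mulrA divfK ?gt_eqF //.
apply: hM.
- by rewrite rt0 powR_invn_lt // ltW.
- by rewrite !ltW.
- by rewrite powR_invnX // ltW.
Qed.

(** The box sides are proportional to the ratios [z' 0 i / z 0 i], so that scaling turns the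
    direction of [z] into that of [z'], up to rounding. Three losses of at most [delta / 4] each
    arise after normalization: bad gaps, [L] exceeding [e], and rounding of the sides. *)
Lemma normalized_rate_compare z z' (delta : R) : positive_on z -> positive_on z' ->
  0 < delta -> exists2 e0 : R, 0 < e0 & forall e, 0 < e < e0 ->
    exists2 e1 : R, 0 < e1 & forall e', 0 < e' < e1 ->
      normalized_rate z e - delta <= normalized_rate z' e'.
Proof.
move=> hz hz' delta0; set a := #|D|.
have [zp zn] := hz; have [zp' zn'] := hz'.
have g0 := geomean_gt0 hz; have g0' := geomean_gt0 hz'.
set g := geomean z in g0; set g' := geomean z' in g0'.
have [B [eB [B0 eB0 hB]]] := normalized_rate_bounded hz'.
have delta1 : 0 < delta * g / 16 by rewrite !mulr_gt0.
have [r0 r00 hr] := rate_compare D0 zp zn delta1.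
have q_gt0 i : D i -> 0 < z 0 i / z' 0 i.
  by move=> Di; apply: divr_gt0; [exact: zp | exact: zp'].
have q_gt0' i : D i -> 0 < z' 0 i / z 0 i.
  by move=> Di; apply: divr_gt0; [exact: zp' | exact: zp].
(* Rounding a side up lengthens the scaled vector by at most [z 0 i <= kappa * z' 0 i] in coordinate
   [i]. *)
pose kappa := \sum_(i | D i) (z 0 i / z' 0 i).
have kappa_ge i : D i -> z 0 i / z' 0 i <= kappa.
  move=> Di; rewrite /kappa (bigD1 i) //= lerDl; apply: sumr_ge0 => j /andP[Dj _].
  by rewrite ltW // q_gt0.
have kappa0 : 0 < kappa.
  have /card_gt0P[i Di] := D0.
  by apply: lt_le_trans (kappa_ge i Di); exact: q_gt0.
exists (Num.min ((r0 / 4) ^+ a) (Num.min 2^-1 (delta / (8 * B)))).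
  rewrite !lt_min; apply/and3P; split.
  - by rewrite exprn_gt0 // divr_gt0.
  - by rewrite invr_gt0.
  - by apply: divr_gt0 => //; exact: mulr_gt0.
move=> e /andP[e0]; rewrite !lt_min => /and3P[er e2 eB1].
pose s := e `^ a%:R^-1; have s0 : 0 < s by exact: powR_gt0.
have sX : s ^+ a = e by rewrite powR_invnX // ltW.
pose L := e / (1 - e); pose l := L `^ a%:R^-1.
have L0 : 0 < L by rewrite divr_gt0 // subr_gt0; lra.
have l0 : 0 < l by exact: powR_gt0.
have lX : l ^+ a = L by rewrite powR_invnX // ltW.
have ls : l <= s * (1 + 2 * e).
  apply: powR_invn_le => //; first exact: ltW.
    by rewrite mulr_ge0 ?(ltW s0) //; lra.
  rewrite exprMn sX /L; apply: ler_wpM2l; first exact: ltW.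
  apply: (@le_trans _ _ (1 + 2 * e)).
    rewrite -[leLHS]mul1r ler_pdivrMr; last lra.
    nra.
  by rewrite -[leLHS]expr1; apply: ler_weXn2l => //; lra.
have L2 : L <= 2 * e by rewrite /L ler_pdivrMr; [nra|lra].
(* The first bound yields [kappa <= t], so that rounding at most doubles the sides; the second makes
   the rounding loss at most [delta / 4]. *)
pose rho1 := Num.min (l * g / (g' * kappa)) (delta * g * s / (4 * kappa * g' * B)).
have rho10 : 0 < rho1 by rewrite lt_min !divr_gt0 ?mulr_gt0.
exists (Num.min (Num.min 1 eB) (rho1 ^+ a)).
  by rewrite !lt_min ltr01 eB0 exprn_gt0.
move=> e' /andP[e'0]; rewrite !lt_min => /andP[/andP[e'1 e'B] e'rho].
pose rho := e' `^ a%:R^-1; have rho0 : 0 < rho by exact: powR_gt0.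
have rhoX : rho ^+ a = e' by rewrite powR_invnX // ltW.
have : rho < rho1 by rewrite powR_invn_lt // ltW.
rewrite lt_min => /andP[rhoA rhoB].
(* Chosen so that the volume of the unrounded box times [e'] is exactly [L]. *)
pose t := l * g / (g' * rho).
have t0 : 0 < t by rewrite divr_gt0 ?mulr_gt0.
have tk : kappa <= t.
  rewrite /t ler_pdivlMr ?mulr_gt0 //; move: rhoA; rewrite ltr_pdivlMr ?mulr_gt0 // => /ltW.
  by rewrite (mulrC rho) (mulrC kappa) mulrAC.
pose k i := if D i then (Num.truncn (t * (z' 0 i / z 0 i))).+1 else 1%N.
have k_lo i : D i -> t * (z' 0 i / z 0 i) <= (k i)%:R.
  by move=> Di; rewrite /k Di ltW // truncnS_gt.
have k_hi i : D i -> (k i)%:R <= t * (z' 0 i / z 0 i) + 1.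
  move=> Di; rewrite /k Di -natr1 lerD2r truncn_le mulr_ge0 ?(ltW t0) //.
  by rewrite ltW // q_gt0'.
have k_hi2 i : D i -> (k i)%:R <= 2 * (t * (z' 0 i / z 0 i)).
  move=> Di; apply: le_trans (k_hi i Di) _.
  suff : 1 <= t * (z' 0 i / z 0 i) by lra.
  have : z 0 i / z' 0 i <= t by exact: le_trans (kappa_ge i Di) tk.
  rewrite ler_pdivrMr ?zp' // => h.
  by rewrite mulrA ler_pdivlMr ?zp // mul1r.
have prodD : \prod_(i | D i) (t * (z' 0 i / z 0 i)) * e' = L.
  rewrite big_split /= prodr_const big_split /= prodfV -(geomeanX hz) -(geomeanX hz').
  rewrite -rhoX -lX -/a -/g -/g' -!expr_div_n -!exprMn; congr (_ ^+ _).
  by rewrite /t; field; rewrite !gt_eqF.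
have prodk : ((\prod_i k i)%N)%:R = \prod_(i | D i) (k i)%:R :> R.
  rewrite natr_prod (bigID D) /= [X in _ * X]big1 ?mulr1 // => i Di.
  by rewrite /k (negPf Di).
pose p := 1 - (1 - e') ^+ (\prod_i k i)%N.
have e'01 : 0 <= e' <= 1 by rewrite !ltW.
have p_lo : e <= p.
  have -> : e = L / (1 + L).
    by rewrite /L; field; rewrite ?gt_eqF; lra.
  apply: one_sub_exp_ge => //; first exact: ltW.
  rewrite -prodD prodk; apply: ler_wpM2r; first exact: ltW.
  apply: ler_prod => i Di; rewrite k_lo // andbT mulr_ge0 ?(ltW t0) //.
  by rewrite ltW // q_gt0'.
(* Rounding costs [2 ^+ a], and the 2 in [L <= 2 * e] is bounded by another [2 ^+ a]; this is why
   [r] is taken to be [4 * s] and why [delta * g / 16] was fixed above. *)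
have p_hi : p <= (4 * s) ^+ a.
  apply: le_trans (one_sub_exp_le _ e'01) _.
  apply: (@le_trans _ _ (2 ^+ a * L)).
    rewrite -prodD prodk mulrA; apply: ler_wpM2r; first exact: ltW.
    rewrite /a -prodr_const -big_split /=; apply: ler_prod => i Di.
    by rewrite ler0n k_hi2.
  rewrite exprMn sX (_ : 4 = 2 * 2) ?exprMn; last by ring.
  rewrite -mulrA ler_pM2l ?exprn_gt0 //; apply: le_trans L2 _.
  rewrite ler_pM2r // -[leLHS]expr1; apply: ler_weXn2l => //.
  by rewrite ler1n.
have e01 : 0 <= e <= 1 by apply/andP; split; lra.
have p1 : p <= 1 by rewrite gerBl exprn_ge0 // subr_ge0 ltW.
have s4 : 0 < 4 * s < r0.
  rewrite mulr_gt0 //= mulrC -ltr_pdivlMr //.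
  by apply: powR_invn_lt => //; rewrite ltW // divr_gt0.
have kz i : (k i)%:R * z 0 i <= (t + kappa) * z' 0 i.
  case: (boolP (D i)) => [Di|nDi]; last by rewrite zn // zn' // !mulr0.
  apply: (@le_trans _ _ ((t * (z' 0 i / z 0 i) + 1) * z 0 i)).
    by apply: ler_wpM2r; [rewrite ltW // zp | exact: k_hi].
  rewrite mulrDl mul1r -mulrA divfK ?gt_eqF ?zp // mulrDl lerD2l.
  by rewrite -ler_pdivrMr ?zp' // kappa_ge.
have k1 i : ~~ D i -> k i = 1%N by move=> /negPf h; rewrite /k h.
have tau0 : 0 <= t + kappa by rewrite addr_ge0 // ltW.
have H := hr (4 * s) p e' (t + kappa) k z' s4 e'01 erefl p_hi k1 (positive_on_ge0 hz') tau0 kz.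
have H2 : rate e z <= rate p z.
  by apply: rate_le_prob => //; [exact: ltW | exact: positive_on_ge0].
have F'B : normalized_rate z' e' <= B by apply: hB; rewrite e'0.
set F' := normalized_rate z' e' in F'B *.
have F'0 : 0 <= F'.
  rewrite /F' divr_ge0 ?mulr_ge0 ?powR_ge0 ?(ltW g0') //; apply: rate_ge0 => //.
  exact: positive_on_ge0.
have rE : rate e' z' = F' * (g' * rho).
  by rewrite /F' /normalized_rate divfK // gt_eqF // mulr_gt0.
rewrite lerBlDr /normalized_rate -/a -/s -/g ler_pdivrMr ?mulr_gt0 //.
apply: le_trans H2 _; apply: le_trans H _; rewrite rE.
have -> : (t + kappa) * (F' * (g' * rho)) = F' * (l * g) + F' * (kappa * (g' * rho)).
  by rewrite /t; field; rewrite !gt_eqF.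
have A1 : F' * (l * g) <= F' * (s * g) + B * (2 * e) * (s * g).
  apply: (@le_trans _ _ (F' * (s * (1 + 2 * e) * g))).
    by apply: ler_wpM2l => //; apply: ler_wpM2r => //; exact: ltW.
  have sg : 0 <= s * g by rewrite mulr_ge0 // ltW.
  have -> : F' * (s * (1 + 2 * e) * g) = F' * (s * g) + F' * (2 * e) * (s * g) by ring.
  rewrite lerD2l; apply: ler_wpM2r => //; apply: ler_wpM2r => //.
  by rewrite mulr_ge0 // ltW.
have A2 : B * (2 * e) * (s * g) <= delta / 4 * (s * g).
  apply: ler_wpM2r; first by rewrite mulr_ge0 // ltW.
  by move: eB1; rewrite ltr_pdivlMr ?mulr_gt0 // => /ltW; lra.
have A3 : F' * (kappa * (g' * rho)) <= delta / 4 * (s * g).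
  apply: (@le_trans _ _ (B * (kappa * (g' * rho)))).
    by apply: ler_wpM2r => //; rewrite !mulr_ge0 // ltW.
  by move: rhoB; rewrite ltr_pdivlMr ?mulr_gt0 // => /ltW; lra.
have A4 : delta * g / 16 * (4 * s) = delta / 4 * (s * g) by field.
rewrite A4 mulrDl (mulrC g s).
move: A1 A2 A3; have : 0 < delta * (s * g) by rewrite !mulr_gt0.
clear; lra.
Qed.

End NormalizedRate.

(** * The limiting constant *)

Section LowerBound.
Context {R : realType} {d : nat}.
Variable D : pred 'I_d.
Hypothesis D0 : (0 < #|D|)%N.

Definition indicator : 'rV[R]_d := \row_i (if D i then 1 else 0).

Lemma positive_on_indicator : positive_on D indicator.
Proof. by split => i Di; rewrite mxE ?Di // (negPf Di). Qed.

Lemma geomean_indicator : geomean D indicator = 1.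
Proof. by rewrite /geomean big1 // => i Di; rewrite mxE Di powR1. Qed.

(** One open edge of direction [j] in [D], anywhere in the box of side [n], saves a step of a
    monotone path across the box. The box is a single cell, so [Ex_coarse] gives the probability of
    such an edge. *)
Lemma gain_at_indicator (p : R) (n : nat) : 0 <= p <= 1 ->
  1 - (1 - p) ^+ (n ^ #|D|)%N <= gain_at p indicator n.
Proof.
move=> p01; have /card_gt0P[j Dj] := D0.
pose k i := if D i then n else 1%N.
have <- : (\prod_i k i = n ^ #|D|)%N.
  rewrite (bigID D) /= [X in (_ * X)%N]big1 ?muln1; last first.
    by move=> i Di; rewrite /k (negPf Di).
  by rewrite -prod_nat_const; apply: eq_bigr => i Di; rewrite /k Di.
pose X : vertex d := floorv (n%:R *: indicator).
have XE i : X 0 i = if D i then n%:Z else 0.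
  by rewrite !mxE; case: (D i); rewrite ?mulr1 ?mulr0 ?floor0 // (intrKfloor n%:Z).
rewrite /gain_at -/X /gain -lerBlDr opprK.
rewrite -lerBrDl.
apply: le_trans (mean_time_le X p01 (cell_uniq k (0, j))) _.
pose Psi (c : edge d -> bool) : R := (nrm X)%:R - (c (0, j))%:R.
apply: (@le_trans _ _ (Ex p (flatten (map (cell k) [:: (0, j)]))
   (fun c => Psi (fun e => has c (cell k e))) (@closed_config _))).
  rewrite /= cats0; apply: Ex_le => // c; rewrite /Psi.
  case: (boolP (has _ _)) => [/hasP[[x i] xc cx]|_]; last first.
    by rewrite subr0 ler_nat -{2}[X]subr0; exact: passage_time_nrm.
  have [/= ij xb] := mem_cell xc; subst i.
  rewrite lerBrDr -natrD ler_nat.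
  apply: leq_trans (_ : chain_cost 0%R [:: (x, (j, true))] X + 1 <= _)%N.
    by rewrite leq_add2r; apply: passage_time_chain_le; rewrite /= cx.
  rewrite [chain_cost _ _ _]/= -lez_nat !PoszD !nrmZ.
  have -> : Posz 1 = \sum_(i < d) (if i == j then 1%R else 0%R) :> int.
    by rewrite -big_mkcond big_pred1_eq.
  rewrite -!big_split /=; apply: ler_sum => i _.
  have := xb i; rewrite [(x - 0) 0 i]mxE [(X - _) 0 i]mxE [(- step_next _ _) 0 i]mxE.
  rewrite step_nextE XE !mxE mulr0 /k.
  case: (boolP (D i)) => [Di|nDi]; first by case: (i == j); mlia.
  have -> : (i == j) = false by apply: contraNF nDi => /eqP ->.
  mlia.
rewrite (Ex_coarse p [:: (0, j)] Psi _ (size_cell k) (@cell_disjoint _ k)) /= /Psi /add_open eqxx /=.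
have -> : has (@closed_config _) (cell k (0, j)) = false.
  by apply/negbTE/hasPn.
rewrite le_eqVlt; apply/orP; left; apply/eqP.
by move: ((1 - p) ^+ _) (nrm X)%:R => *; rewrite subr0; ring.
Qed.

Lemma normalized_rate_indicator_ge (e : R) : 0 < e < 1 ->
  4^-1 <= normalized_rate D indicator e.
Proof.
move=> /andP[e0 e1]; set a := #|D|.
have e01 : 0 <= e <= 1 by rewrite !ltW.
pose rho := e `^ a%:R^-1; have rho0 : 0 < rho by exact: powR_gt0.
have rhoX : rho ^+ a = e by rewrite powR_invnX // ltW.
have rho1 : rho <= 1 by rewrite powR_invn_le ?expr1n // ltW.
(* The smallest scale at which a box contains at least one open edge on average: it is then open
   with probability at least 1/2, and [k * rho <= 2] costs the other factor 2 in [4^-1]. *)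
pose k := (Num.truncn rho^-1).+1.
have k1 : rho^-1 <= k%:R by rewrite ltW // truncnS_gt.
have k2 : k%:R <= rho^-1 + 1.
  by rewrite /k -natr1 lerD2r truncn_le invr_ge0 ltW.
have h1 := gain_at_indicator k e01.
have h2 := rate_ge e01 (positive_on_ge0 positive_on_indicator) k.
have h3 : 2^-1 <= 1 - (1 - e) ^+ (k ^ a)%N.
  have -> : 2^-1 = 1 / (1 + 1) :> R by rewrite mul1r.
  apply: one_sub_exp_ge => //.
  apply: (@le_trans _ _ (rho^-1 ^+ a * e)).
    by rewrite -rhoX exprVn mulVf // expf_neq0 // gt_eqF.
  apply: ler_wpM2r; first exact: ltW.
  by rewrite natrX ler_pXn2r // nnegrE // invr_ge0 ltW.
rewrite /normalized_rate geomean_indicator mul1r -/a -/rho ler_pdivlMr //.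
have r0 : 0 <= rate e indicator by apply: rate_ge0 => //; exact: positive_on_ge0 positive_on_indicator.
have k3 : k%:R * rho <= 2.
  apply: le_trans (ler_wpM2r (ltW rho0) k2) _.
  by rewrite mulrDl mulVf ?gt_eqF // mul1r -[leRHS]/(1 + 1) lerD2l.
have h4 : 2^-1 <= k%:R * rate e indicator by apply: le_trans h3 _; apply: le_trans h1 _.
have k0 : 0 < k%:R :> R by rewrite ltr0n.
rewrite -(ler_pM2l k0) mulrCA; move: h4 k3; move: (k%:R * rate _ _) (k%:R * rho) => x y.
by clear; lra.
Qed.

(** The lower limit at 0 of the normalized rate of the indicator, as the supremum of its eventual
    lower bounds. *)
Definition rate_constant : R := sup [set x | exists2 e1 : R, 0 < e1 &
  forall e, 0 < e < e1 -> x <= normalized_rate D indicator e].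

Lemma rate_constant_has_sup : has_sup [set x | exists2 e1 : R, 0 < e1 &
  forall e, 0 < e < e1 -> x <= normalized_rate D indicator e].
Proof.
split; first by exists 4^-1, 1 => // e; exact: normalized_rate_indicator_ge.
have [B [e0 [B0 e00 hB]]] := normalized_rate_bounded D0 positive_on_indicator.
exists B => x [e1 e10 h].
have m0 : 0 < Num.min e0 e1 by rewrite lt_min e00.
have [m1 m2] : Num.min e0 e1 <= e0 /\ Num.min e0 e1 <= e1 by rewrite !ge_min !lexx orbT.
apply: (@le_trans _ _ (normalized_rate D indicator (Num.min e0 e1 / 2))).
  by apply: h; apply/andP; split; lra.
by apply: hB; apply/andP; split; lra.
Qed.

Lemma rate_constant_gt0 : 0 < rate_constant.
Proof.
apply: lt_le_trans (_ : 4^-1 <= _); first by rewrite invr_gt0.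
apply: ub_le_sup; first by case: rate_constant_has_sup.
by exists 1 => // e; exact: normalized_rate_indicator_ge.
Qed.

(** From below, one small parameter at which the indicator nearly attains the constant is compared
    with [z]. From above, comparing [z] with the indicator shows that the normalized rate of [z]
    minus [delta] is itself an eventual lower bound for the indicator. *)
Lemma normalized_rate_limit z (delta : R) : positive_on D z -> 0 < delta ->
  exists2 e1 : R, 0 < e1 & forall e, 0 < e < e1 ->
    `|normalized_rate D z e - rate_constant| <= delta.
Proof.
move=> hz delta0; have h1 := positive_on_indicator.
have d2 : 0 < delta / 2 by rewrite divr_gt0.
have [x [ex ex0 hx] xC] := sup_adherent d2 rate_constant_has_sup.
have [e0 e00 he0] := normalized_rate_compare D0 h1 hz d2.
have m0 : 0 < Num.min e0 ex by rewrite lt_min e00.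
have [m1 m2] : Num.min e0 ex <= e0 /\ Num.min e0 ex <= ex by rewrite !ge_min !lexx orbT.
have [|eL eL0 lower] := he0 (Num.min e0 ex / 2); first by apply/andP; split; lra.
have [eU eU0 upper] := normalized_rate_compare D0 hz h1 delta0.
exists (Num.min eL eU); first by rewrite lt_min eL0.
move=> e /andP[ep]; rewrite lt_min => /andP[eel eeu].
rewrite ler_norml; apply/andP; split.
  have {}hx : x <= normalized_rate D indicator (Num.min e0 ex / 2).
    by apply: hx; apply/andP; split; lra.
  have := lower e; rewrite ep eel => /(_ isT).
  by move: xC; rewrite -/rate_constant; move: (normalized_rate _ _ _) (normalized_rate _ _ _) hx => *; lra.
rewrite lerBlDr -lerBlDl; apply: ub_le_sup; first by case: rate_constant_has_sup.
have [|e1 e10 h] := upper e; first by rewrite ep.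
by exists e1.
Qed.

End LowerBound.

(** * Law of the passage time *)

Section Law.
Context (d0 : measure_display) (Om : measurableType d0) (R : realType) (d : nat).
Variables (eps : R) (P : probability Om R) (tau : edge d -> Om -> R).
Hypotheses (eps01 : 0 <= eps <= 1) (bern : bernoulli_fpp eps P tau).

Let mtau u : measurable_fun setT (tau u). Proof. by case: bern. Qed.

Fixpoint sampled_config (s : seq (edge d)) (c : edge d -> bool) (w : Om)
    : edge d -> bool :=
  if s is e :: s' then
    if tau e w == 0 then sampled_config s' (add_open c e) w
    else sampled_config s' c w
  else c.

Lemma sampled_configE s c w e :
  sampled_config s c w e = c e || ((e \in s) && (tau e w == 0)).
Proof.
elim: s c => [|f s IH] c /=; first by rewrite orbF.
case: ifP => tf; rewrite IH /add_open inE; case: (e =P f) => //= ->; rewrite tf //=.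
  by rewrite !orbT.
by rewrite !andbF.
Qed.

Lemma measurable_sampled_config (phi : (edge d -> bool) -> R) s c :
  measurable_fun setT (fun w => phi (sampled_config s c w)).
Proof.
elim: s c => [|e s IH] c /=; first exact: measurable_cst.
rewrite (_ : (fun w => _) = (fun w => if tau e w == 0
   then phi (sampled_config s (add_open c e) w) else phi (sampled_config s c w))); last first.
  by apply/funext => w; case: ifP.
apply: measurable_fun_ifT => //; apply: measurable_fun_eqr => //.
Qed.

Let bset (b : bool) : set R := if b then [set 0] else ~` [set 0].
Let prob (b : bool) : R := if b then eps else 1 - eps.

Let mbset b : measurable (bset b).
Proof. by rewrite /bset; case: b; [|apply: measurableC]; exact: measurable_set1. Qed.

Let Pbset u b : P (tau u @^-1` bset b) = (prob b)%:E.
Proof.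
have [_ _ h _] := bern; have {}h : P (tau u @^-1` [set 0]) = eps%:E by exact: h.
have mb : measurable (tau u @^-1` [set 0]).
  by rewrite -[X in measurable X]setTI; exact: mtau.
by rewrite /bset; case: b => //=; rewrite -preimage_setC probability_setC // h EFinB.
Qed.

Let cyl (t : seq (edge d)) (b : edge d -> bool) : set Om :=
  [set w | forall i, i \in t -> (tau i w == 0) = b i].

Let cylE t b : cyl t b = \bigcap_(i in [set` t]) (tau i @^-1` bset (b i)).
Proof.
apply/seteqP; split => w h i /= it; have := h i it; rewrite /= /bset.
  by case: (b i) => /= /eqP.
by case: (b i) => /= /eqP => [-> //|/negPf].
Qed.

Let mcyl t b : measurable (cyl t b).
Proof.
rewrite cylE; apply: fin_bigcap_measurable => [|i _]; first exact: finite_seq.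
by rewrite -[X in measurable X]setTI; exact: mtau.
Qed.

Let Pcyl t b : uniq t -> P (cyl t b) = (\prod_(i <- t) prob (b i))%:E.
Proof.
move=> ut; have [_ _ _ ind] := bern.
rewrite cylE (ind t (fun i => bset (b i)) ut) // -prodEFin.
by apply: eq_bigr => i _; exact: Pbset.
Qed.

(** Cylinders carry the induction: splitting on the state of the next edge leaves integrals over two
    smaller cylinders. Mutual independence enters in the base case, through the probability of a
    cylinder. *)
Lemma integral_sampled_config_cyl (phi : (edge d -> bool) -> R) s c t b :
  (forall c, 0 <= phi c) -> uniq (s ++ t) ->
  (\int[P]_(w in cyl t b) (phi (sampled_config s c w))%:E =
    (\prod_(i <- t) prob (b i) * Ex eps s phi c)%:E)%E.
Proof.
move=> phi0; elim: s c t b => [|e s IH] c t b /= us.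
  transitivity ((phi c)%:E * P (cyl t b))%E; first exact: integral_cst.
  by rewrite Pcyl // -EFinM mulrC.
pose upd v i := if i == e then v else b i.
have [est ust] := andP us; move: est; rewrite mem_cat negb_or => /andP[es et].
have cylU : cyl t b = cyl (e :: t) (upd true) `|` cyl (e :: t) (upd false).
  apply/seteqP; split => w /=.
    move=> h; case te : (tau e w == 0); [left|right] => i; rewrite inE /upd => /orP[/eqP ->|it].
    - by rewrite eqxx te.
    - by case: (i =P e) => [->|_]; [rewrite te|exact: h].
    - by rewrite eqxx te.
    - by case: (i =P e) => [->|_]; [rewrite te|exact: h].
  move=> [] h i it; have := h i; rewrite inE it orbT /upd => /(_ isT);
    by case: (i =P e) => // ie; rewrite -ie it in et.
have cyle v w : cyl (e :: t) (upd v) w -> (tau e w == 0) = v.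
  by move=> /(_ e); rewrite mem_head /upd eqxx => /(_ isT).
have prodE v : \prod_(i <- e :: t) prob (upd v i) = prob v * \prod_(i <- t) prob (b i).
  rewrite big_cons {1}/upd eqxx; congr (_ * _); apply: eq_big_seq => i it.
  by rewrite /upd; case: (i =P e) => // ie; rewrite -ie it in et.
have ust' : uniq (s ++ e :: t).
  by rewrite -cat1s uniq_catCA cat1s.
rewrite cylU ge0_integral_setU //; first last.
- apply/disj_setPS => w [h1 h2] /=.
  by have := cyle true w h1; rewrite (cyle false w h2).
- by move=> w _; rewrite lee_fin.
- apply/measurable_EFinP; apply: measurable_funS (measurable_sampled_config phi (e :: s) c) => //.
rewrite (eq_integral (fun w => (phi (sampled_config s (add_open c e) w))%:E)); last first.
  by move=> w; rewrite inE => /cyle ->.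
rewrite [X in (_ + X)%E](eq_integral (fun w => (phi (sampled_config s c w))%:E)); last first.
  by move=> w; rewrite inE => /cyle ->.
rewrite !IH // !prodE -EFinD; congr (_%:E); rewrite /prob /=; ring.
Qed.

Lemma integral_sampled_config (phi : (edge d -> bool) -> R) s c :
  (forall c, 0 <= phi c) -> uniq s ->
  (\int[P]_w (phi (sampled_config s c w))%:E = (Ex eps s phi c)%:E)%E.
Proof.
move=> phi0 us; have := @integral_sampled_config_cyl phi s c [::] (fun=> true) phi0.
rewrite cats0 big_nil mul1r => /(_ us) <-; congr integral.
by apply/seteqP; split.
Qed.

Lemma ae_tau01 : \forall w \ae P, forall e, tau e w = 0 \/ tau e w = 1.
Proof.
have H e : \forall w \ae P, tau e w = 0 \/ tau e w = 1.
  have [_ h1 h0 _] := bern.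
  have m0 : measurable [set w | tau e w = 0].
    by rewrite -[X in measurable X]setTI; exact: (mtau e measurableT (measurable_set1 0)).
  have m1 : measurable [set w | tau e w = 1].
    by rewrite -[X in measurable X]setTI; exact: (mtau e measurableT (measurable_set1 1)).
  exists (~` ([set w | tau e w = 0] `|` [set w | tau e w = 1])); split.
  - exact/measurableC/measurableU.
  - rewrite probability_setC; last exact: measurableU.
    set A0 := [set w | tau e w = 0]; set A1 := [set w | tau e w = 1].
    have -> : P (A0 `|` A1) = (P A0 + P A1)%E.
      apply: measureU => //; apply/seteqP; split => // w [].
      rewrite /A0 /A1 /= => -> /esym/eqP.
      by rewrite oner_eq0.
    by rewrite h0 h1 -EFinD (addrC eps) subrK subrr.
  - exact: subset_refl.
have := @ae_foralln _ _ _ P (fun n w => if @unpickle (edge d) n is Some e then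
   tau e w = 0 \/ tau e w = 1 else True).
move=> /(_ _)[n|A [mA A0 hA]].
  case: (unpickle n) => [e|]; first exact: H.
  exact: aeW.
exists A; split => // w hw; apply: hA => h; apply: hw => e.
by have := h (pickle e); rewrite pickleK.
Qed.

Lemma measurable_path_time x p : measurable_fun setT (fun w => path_time (tau^~ w) x p).
Proof.
elim: p x => [|s p IH] x /=; first exact: measurable_cst.
exact: measurable_funD.
Qed.

Lemma measurable_fpp_time x y : measurable_fun setT (fun w => fpp_time (tau^~ w) x y).
Proof.
(* There are countably many paths; codes that give no path from [x] to [y] receive [+oo], which does
   not affect the infimum. *)
pose g (n : nat) (w : Om) : \bar R :=
  if @unpickle (seq (step d)) n is Some p then
    if path_end x p == y then (path_time (tau^~ w) x p)%:E else +oo%E else +oo%E.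
have -> : (fun w => fpp_time (tau^~ w) x y) = (fun w => einfs (g^~ w) 0%N).
  apply/funext => w; rewrite /fpp_time /einfs /=; apply/eqP; rewrite eq_le.
  apply/andP; split; apply/ereal_infP => z /=.
    move=> [n _ <-]; rewrite /g; case: (unpickle n) => [p|]; last exact: leey.
    case: eqP => pe; last exact: leey.
    by apply: ereal_inf_lbound; exists p.
  move=> [p pe <-]; apply: ereal_inf_lbound; exists (pickle p) => //.
  by rewrite /g pickleK pe eqxx.
apply: measurable_fun_einfs => n; rewrite /g.
case: (unpickle n) => [p|]; last exact: measurable_cst.
case: eqP => _; last exact: measurable_cst.
by apply/measurable_EFinP; exact: measurable_path_time.
Qed.

Lemma fpp_time_passage_time x y w : (forall e, tau e w = 0 \/ tau e w = 1) ->
  fpp_time (tau^~ w) x y = ((passage_time (fun e => tau e w == 0) x y)%:R)%:E.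
Proof.
move=> h01; pose c := fun e => tau e w == 0; rewrite -/c.
have ptE v p : path_time (tau^~ w) v p = (nclosed c v p)%:R.
  elim: p v => //= s p IH v; rewrite IH natrD; congr (_ + _); rewrite /c.
  by case: (h01 (step_edge v s)) => ->; rewrite ?eqxx // oner_eq0.
apply/eqP; rewrite eq_le; apply/andP; split.
  have [p pe <-] := passage_time_path c x y.
  by apply: ereal_inf_lbound; exists p => //; rewrite ptE.
apply/ereal_infP => _ [p <- <-]; rewrite lee_fin ptE ler_nat.
exact: passage_time_le.
Qed.

Let enum_edges N : seq (edge d) := undup (pmap (@unpickle (edge d)) (iota 0 N)).

Let mem_enum_edges e N : (pickle e < N)%N -> e \in enum_edges N.
Proof.
move=> h; rewrite mem_undup mem_pmap; apply/mapP; exists (pickle e).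
  by rewrite mem_iota.
by rewrite pickleK.
Qed.

Let sub_enum_edges (s : seq (edge d)) :
  exists N0, forall N, (N0 <= N)%N -> {subset s <= enum_edges N}.
Proof.
exists (\max_(e <- s) (pickle e).+1)%N => N hN e es; apply: mem_enum_edges.
by apply: leq_trans hN; rewrite (big_rem e es) leq_maxl.
Qed.

Fixpoint path_edges (v : vertex d) (p : seq (step d)) : seq (edge d) :=
  if p is s :: p' then step_edge v s :: path_edges (step_next v s) p' else [::].

Lemma eq_nclosed (c c' : edge d -> bool) v p : {in path_edges v p, c =1 c'} ->
  nclosed c v p = nclosed c' v p.
Proof.
elim: p v => //= s p IH v h; rewrite h ?mem_head // IH // => e ep.
by apply: h; rewrite inE ep orbT.
Qed.

(** Only the first [N] edges of an enumeration are allowed to be open. Almost surely the passage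
    time is then eventually constant in [N], since an optimal path uses finitely many edges and
    closing edges never helps; [nrm x] dominates. *)
Lemma integral_fpp_time (x : vertex d) :
  (\int[P]_w fpp_time (tau^~ w) (0 : vertex d)%R x = (mean_time eps x)%:E)%E.
Proof.
pose phi (c : edge d -> bool) : R := (passage_time c 0 x)%:R.
pose f N (w : Om) : \bar R :=
  (phi (sampled_config (enum_edges N) (@closed_config _) w))%:E.
have uE N : uniq (enum_edges N) by exact: undup_uniq.
have fle (c : edge d -> bool) : phi c <= (nrm x)%:R.
  by rewrite ler_nat -{2}[x]subr0; exact: passage_time_nrm.
have fcvg : \forall w \ae P, setT w -> f N w @[N --> \oo] --> fpp_time (tau^~ w) 0 x.
  apply: filterS ae_tau01 => w h01 _; rewrite fpp_time_passage_time //.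
  pose c := fun e => tau e w == 0; rewrite -/c.
  have [p pe pc] := passage_time_path c 0 x.
  have [N0 hN0] := sub_enum_edges (path_edges 0 p).
  apply: cvg_near_cst; exists N0 => // N /= hN.
  rewrite /f /phi; congr (_%:R%:E); apply/eqP; rewrite eqn_leq; apply/andP; split.
    rewrite -pc -pe; apply: leq_trans (passage_time_le _ _ _) _.
    rewrite (@eq_nclosed _ c) // => e ep.
    by rewrite sampled_configE /= (hN0 N hN e ep).
  apply: passage_time_antitone => e; rewrite sampled_configE /=.
  by move=> /andP[].
have mf N : measurable_fun setT (f N).
  by apply/measurable_EFinP; exact: measurable_sampled_config.
have mfpp := measurable_fpp_time 0 x.
have icst : P.-integrable setT (EFin \o cst (nrm x)%:R).
  exact: finite_measure_integrable_cst.
have dom : \forall w \ae P, forall n, setT w -> (`|f n w| <= (EFin \o cst (nrm x)%:R) w)%E.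
  by apply: aeW => w n _; rewrite gee0_abs lee_fin ?ler0n //; exact: fle.
have [_ _] := dominated_convergence measurableT mf mfpp fcvg icst dom.
rewrite (_ : (fun n => _) = (fun n => (Ex eps (enum_edges n) phi (@closed_config _))%:E)); last first.
  by apply/funext => n; rewrite integral_sampled_config // => c; exact: ler0n.
move=> /cvg_lim <- //; apply/cvg_lim => //.
apply: cvg_EFin; first by near=> n.
apply/cvgrPdist_le => e e0.
have [_ [s us <-] hs] : exists2 y, [set Ex eps s phi (@closed_config _)
      | s in [set s | uniq s]] y & y < mean_time eps x + e.
  apply: inf_adherent => //; split.
    by exists (Ex eps [::] phi (@closed_config _)), [::].
  by exists 0 => _ [t _ <-]; exact: Ex_passage_time_ge0.
have [N0 hN0] := sub_enum_edges s.
exists N0 => // N /= hN.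
have h1 := mean_time_le x eps01 (uE N).
have h2 : Ex eps (enum_edges N) phi (@closed_config _) <= Ex eps s phi (@closed_config _).
  apply: Ex_subset_le => //; first exact: passage_time_antitone_config.
  exact: hN0.
rewrite /= ler0_norm ?subr_le0 //; rewrite -/phi in h1.
by rewrite opprB lerBlDl ltW // (le_lt_trans h2).
Unshelve. all: by end_near. Qed.

End Law.

(** * The time constant *)

Definition first_coords d (a : nat) : pred 'I_d := fun i => (i < a)%N.

Lemma card_first_coords d a : (a <= d)%N -> #|first_coords (d := d) a| = a.
Proof.
move=> ad; rewrite -sum1_card (eq_bigl (fun i : 'I_d => (i < a)%N)) //.
by rewrite (big_ord_narrow ad) sum_nat_const card_ord muln1.
Qed.

Lemma support_to_front d (A : pred 'I_d) : exists f g : 'I_d -> 'I_d,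
  [/\ cancel f g, cancel g f & forall i, A (f i) = first_coords #|A| i].
Proof.
pose s := enum A ++ enum (predC A).
have sz : size s = d by rewrite size_cat -!cardE cardC card_ord.
have us : uniq s.
  rewrite cat_uniq !enum_uniq andbT /=; apply/hasPn => i.
  by rewrite !mem_enum.
have ins i : i \in s by rewrite mem_cat !mem_enum !unfold_in /= orbN.
have idx i : (index i s < d)%N by rewrite -{2}sz index_mem.
exists (fun i => nth i s i), (fun i => Ordinal (idx i)); split.
- by move=> i; apply/val_inj; rewrite /= index_uniq // sz.
- by move=> i /=; rewrite nth_index.
move=> i; rewrite nth_cat -cardE /first_coords; case: ltnP => h.
  by have := mem_nth i (n := i) (s := enum A); rewrite -cardE mem_enum => /(_ h).
have := mem_nth i (n := i - #|A|) (s := enum (predC A)).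
rewrite -cardE mem_enum => /(_ _) H; apply/negbTE/H.
by rewrite ltn_subLR // cardC card_ord.
Qed.

Section TimeConstant.
Context {R : realType} {d : nat}.
Variables (z : 'rV[R]_d) (f g : 'I_d -> 'I_d).
Hypotheses (fg : cancel f g) (gf : cancel g f).

Definition abs_perm : 'rV[R]_d := \row_i `|z 0 (f i)|.

Let az0 i : 0 <= abs_perm 0 i. Proof. by rewrite mxE. Qed.

Lemma norm1_abs_perm : norm1 abs_perm = norm1 z.
Proof.
rewrite /norm1 [RHS](reindex_onto f g) => [|i _]; last exact: gf.
by rewrite (eq_bigl xpredT) => [|i]; [apply: eq_bigr => i _; rewrite mxE normr_id | rewrite fg eqxx].
Qed.

(** The integer part does not commute with reflections: the floors of [u] and [- u] add up to 0 or
    -1, an error of at most 1 per coordinate. *)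
Lemma mean_time_abs_perm (p : R) n : 0 <= p <= 1 ->
  `|mean_time p (floorv (n%:R *: z)) -
    ((nrm (floorv (n%:R *: abs_perm)))%:R - gain_at p abs_perm n)| <= d%:R.
Proof.
move=> p01; rewrite /gain_at /gain subKr.
pose sg i := z 0 (f i) < 0.
rewrite -(mean_time_signed_perm sg _ p01 fg gf) distrC.
set x := floorv (n%:R *: abs_perm); set y := signed_perm _ _ _.
have xy : (nrm (x - y) <= d)%N.
  rewrite -[leqRHS]muln1 -[X in (X * 1)%N]card_ord -sum_nat_const; apply: leq_sum => i _.
  rewrite /x /y /sg !mxE; case: ifP => zi; last first.
    by rewrite ger0_norm ?leNgt ?zi // subrr.
  rewrite ltr0_norm // mulrN opprK.
  set u := n%:R * _; have h1 := floor_le u; have h2 := floor_le (- u).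
  have h3 := floorD1_gt u; have h4 := floorD1_gt (- u).
  have : (Num.floor (- u) + Num.floor u)%:~R <= 0 :> R by rewrite intrD; lra.
  have : - 2 < (Num.floor (- u) + Num.floor u)%:~R :> R.
    by move: h3 h4; rewrite !intrD; lra.
  rewrite (_ : - 2 = (- 2%:Z)%:~R) // ltr_int (_ : 0 = (0%:Z)%:~R) // ler_int.
  by move: (Num.floor _) (Num.floor _) => *; lia.
have h1 := mean_time_nrmB x y p01; have h2 := mean_time_nrmB y x p01.
rewrite nrmB in h2; move: xy; rewrite -(ler_nat R) => xy.
by rewrite ler_norml; apply/andP; split; lra.
Qed.

Lemma nrm_floorv_abs_perm n :
  `|(nrm (floorv (n%:R *: abs_perm)))%:R - n%:R * norm1 z| <= d%:R.
Proof.
rewrite ler0_norm ?subr_le0 -?norm1_abs_perm ?nrm_floorv // opprB lerBlDl.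
rewrite /norm1 mulr_sumr /nrm natr_sum -[d%:R]mul1r -[X in 1 * X%:R]card_ord.
rewrite mulr_natr -sumr_const -big_split /=; apply: ler_sum => i _.
have h := floorv_ge0 az0 n i.
rewrite natr_absz (ger0_norm h) ger0_norm // [floorv _ _ _]mxE.
rewrite [(_ *: abs_perm) 0 i]mxE ltW //.
by have := floorD1_gt (n%:R * abs_perm 0 i); rewrite intrD.
Qed.

Lemma time_constantE (d0 : measure_display) (Om : measurableType d0)
    (P : probability Om R) (tau : edge d -> Om -> R) (eps : R) :
  0 <= eps <= 1 -> bernoulli_fpp eps P tau ->
  time_constant P tau z = norm1 z - rate eps abs_perm.
Proof.
move=> e01 bern; apply/cvg_lim => //.
have seqE n : time_constant_seq P tau z n = mean_time eps (floorv (n.+1%:R *: z)) / n.+1%:R.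
  by rewrite /time_constant_seq (integral_fpp_time e01 bern).
apply/cvgrPdist_le => e e0.
have e2 : 0 < e / 2 by rewrite divr_gt0.
have := rate_cvg e01 az0; move/cvgrPdist_le => /(_ _ e2) near1.
near=> n.
rewrite seqE.
have n0 : 0 < n.+1%:R :> R by [].
have h1 := mean_time_abs_perm n.+1 e01; have h2 := nrm_floorv_abs_perm n.+1.
have h3 : `|rate eps abs_perm - gain_at eps abs_perm n.+1 / n.+1%:R| <= e / 2.
  by near: n.
have h4 : (2 * d)%:R / n.+1%:R <= e / 2.
  rewrite ler_pdivrMr // mulrC -ler_pdivrMr //.
  apply: le_trans (_ : n%:R <= _); last by rewrite ler_nat.
  near: n; exact: nbhs_infty_ger.
set M := mean_time _ _ in h1 *; set N := (nrm _)%:R in h1 h2; set G := gain_at _ _ _ in h1 h3.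
set r := rate _ _ in h3 *.
have -> : norm1 z - r - M / n.+1%:R =
   - ((M - (N - G)) + (N - n.+1%:R * norm1 z)) / n.+1%:R - (r - G / n.+1%:R).
  by field; rewrite gt_eqF.
apply: le_trans (ler_normB _ _) _; rewrite [leRHS](splitr e); apply: lerD => //.
apply: le_trans h4; rewrite normrM normrN [`|_^-1|]ger0_norm ?invr_ge0 //.
apply: ler_wpM2r; first by rewrite invr_ge0.
apply: le_trans (ler_normD _ _) _.
by rewrite mul2n -addnn natrD lerD.
Unshelve. all: by end_near. Qed.

End TimeConstant.

Theorem theorem1 (R : realType) :
  exists C : nat -> nat -> R,
    (forall a b : nat, (1 <= a)%N -> 0 < C a b) /\
    forall (d : nat) (z : 'rV[R]_d), (2 <= d)%N -> z != 0 ->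
    forall (d0 : measure_display) (Om : measurableType d0)
           (P : R -> probability Om R) (tau : R -> edge d -> Om -> R),
      (forall eps, 0 <= eps <= 1 -> bernoulli_fpp eps (P eps) (tau eps)) ->
      (fun eps : R =>
         (time_constant (P eps) (tau eps) z
          - (norm1 z - C (d1 z) (d2 z) * gammaz z * eps `^ (d1 z)%:R^-1))
         / eps `^ (d1 z)%:R^-1) @ 0^'+ --> (0 : R).
Proof.
(* The reference problem for [a] and [b] lives in dimension [a + b], with the indicator of the first
   [a] coordinates as direction; permutations and reflections bring every [z] to this support. *)
exists (fun a b => rate_constant (R := R) (first_coords (d := a + b) a)); split.
  move=> a b a1; apply: rate_constant_gt0.
  by rewrite card_first_coords ?leq_addr.
move=> d z _ zN0 d0 Om P tau bern.
set a := d1 z.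
have ad : (a <= d)%N by rewrite -[leqRHS]card_ord; exact: max_card.
rewrite /d2 -/a subnKC //.
set D := first_coords a; set C := rate_constant D.
have cD : #|D| = a by exact: card_first_coords.
have a0 : (0 < a)%N.
  have [i zi] : exists i, z 0 i != 0.
    apply/existsP; rewrite -negb_forall; apply: contra zN0 => /forallP h.
    by apply/eqP/rowP => i; rewrite mxE; exact/eqP.
  by apply/card_gt0P; exists i; rewrite inE.
have D0 : (0 < #|D|)%N by rewrite cD.
have [f [g [fg gf fA]]] := support_to_front (fun i => z 0 i != 0).
have {}fA i : (z 0 (f i) != 0) = D i.
  rewrite fA /D /a /d1; congr (first_coords _ _).
  by apply: eq_card => j; apply/idP/idP; rewrite in_setE.
pose w := abs_perm z f.
have hw : positive_on D w.
  split => i Di; rewrite mxE; first by rewrite normr_gt0 fA.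
  by apply/eqP; rewrite normr_eq0 -[_ == _]negbK fA.
have gE : gammaz z = geomean D w.
  rewrite /gammaz /geomean cD -/a [LHS](reindex_onto f g) => [|i _]; last exact: gf.
  apply: eq_big => [i|i _]; first by rewrite fA fg eqxx andbT.
  by rewrite mxE.
have gam0 : 0 < gammaz z by rewrite gE; exact: geomean_gt0.
apply/cvgrPdist_le => e e0.
(* Up to sign, the quotient to be bounded is [gammaz z] times the deviation of the normalized rate
   from [C], hence the tolerance [e / gammaz z]. *)
have [e1 e10 he1] := normalized_rate_limit D0 hw (divr_gt0 e0 gam0).
near=> eps.
have ep : 0 < eps by [].
have e1' : eps < e1 by near: eps; exact: nbhs_right_lt.
have ep1 : eps < 1 by near: eps; exact: nbhs_right_lt.
have e01 : 0 <= eps <= 1 by rewrite !ltW.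
rewrite (time_constantE z fg gf e01 (bern _ e01)) sub0r normrN.
set s := eps `^ _; have s0 : 0 < s by exact: powR_gt0.
have := he1 eps; rewrite ep e1' => /(_ isT).
rewrite /normalized_rate -gE cD -/s -/C -/w ler_pdivlMr //.
apply: le_trans; rewrite -[X in _ <= _ * X](gtr0_norm gam0) -normrM.
rewrite le_eqVlt; apply/orP; left; apply/eqP; rewrite -normrN; congr `|_|.
by field; rewrite !gt_eqF.
Unshelve. all: by end_near. Qed.
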